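(* Let $\mathcal{G}=(V,\mathcal{B},E)$ be a Borel multi-graph of bounded maximum degree and let $\mu$ be a Borel probability measure on $(V,\mathcal{B})$ (not necessarily invariant). Then $\chi'_{AP,\mu}(\mathcal{G})\le\Delta(\mathcal{G})+\pi(\mathcal{G})$.
   Context: A Borel multi-graph with multiplicity at most $\pi\in\mathbb{N}$ is a triple $(V,\mathcal{B},E)$ where $(V,\mathcal{B})$ is a standard Borel space and $E$ is a Borel subset of $[V]^2\times[\pi]$ ($[V]^2$ the unordered pairs of distinct elements of $V$); elements $(\{x,y\},k)\in E$ are the (parallel) edges with endpoints $x,y$. $\Delta(\mathcal{G})$ is the maximum degree (number of edges at a vertex, counted with multiplicity), assumed finite, and $\pi(\mathcal{G})$ the maximum edge multiplicity. For $A\subseteq V$, $\mathcal{G}\upharpoonright A$ is the Borel multi-graph on $A$ with edge set $E\cap([A]^2\times[\pi(\mathcal{G})])$. The Borel chromatic index $\chi'_{\mathcal{B}}$ of a Borel multi-graph is the smallest number of Borel matchings (sets of pairwise disjoint edges; parallel edges are not disjoint) that partition its edge set. The $\mu$-approximate chromatic index $\chi'_{AP,\mu}(\mathcal{G})$ is the smallest integer $k$ such that for every $\epsilon>0$ there is a Borel set $A\subseteq V$ with $\mu(V\setminus A)\le\epsilon$ and $\chi'_{\mathcal{B}}(\mathcal{G}\upharpoonright A)\le k$. *)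

(* Defs.v *)
From HB Require Import structures.
From mathcomp Require Import all_boot all_order all_algebra.
From mathcomp Require Import all_classical all_reals all_analysis.

Set Implicit Arguments.
Unset Strict Implicit.
Unset Printing Implicit Defensive.

Import Order.TTheory GRing.Theory Num.Theory.

Local Open Scope classical_set_scope.
Local Open Scope ring_scope.
Local Open Scope ereal_scope.

(* V is isomorphic, as a measurable space, to a Polish space T (separable and
   completely metrizable) with its Borel sets. The distances of T take values
   in R, which stands for the real numbers. *)
Definition standard_borel (R : realType) d (V : measurableType d) : Prop :=
  exists (T : completePseudoMetricType R) (f : V -> T),
    [/\ hausdorff_space T,
        exists2 D : set T, countable D & dense D,
        set_bij [set: V] [set: T] f &
        forall A : set V, measurable A <-> <<s @open T >> (f @` A)].

(* [X]^2: the unordered pairs {x, y} of distinct elements of X *)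
Definition unordered_pairs (T : Type) (X : set T) : set (set T) :=
  [set [set p.1; p.2] | p in [set p : T * T | [/\ X p.1, X p.2 & p.1 <> p.2]]].

(* The parallel edges with endpoints x and y are ([set x; y], k), where the
   label k ranges over {0, ..., m-1} instead of {1, ..., m}. *)
Definition edge (T : Type) (m : nat) : Type := (set T * 'I_m)%type.

(* The Borel structure of [V]^2 is the quotient of that of
   {(x, y) in V * V | x != y} by the flip, and the set of labels is discrete. *)
Definition borel_edge_set d (V : measurableType d) m (F : set (edge V m)) :=
  forall k : 'I_m,
    measurable [set p : V * V | p.1 <> p.2 /\ F ([set p.1; p.2], k)].

(* A Borel multi-graph on a Borel subset X of V. The Borel subsets of X and of
   [X]^2 are those of V and of [V]^2 that are contained in X and in [X]^2. *)
Record borel_multigraph d (V : measurableType d) (X : set V) (m : nat) := {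
  edges : set (edge V m) ;
  measurable_vertices : measurable X ;
  edges_sub : edges `<=` unordered_pairs X `*` [set: 'I_m] ;
  borel_edges : borel_edge_set edges }.

Section restrict.
Context d (V : measurableType d) (X : set V) (m : nat).
Variables (G : borel_multigraph X m) (A : set V) (mA : measurable A).

Definition restrict_edges : set (edge V m) :=
  edges G `&` (unordered_pairs A `*` [set: 'I_m]).

Lemma restrict_edges_sub :
  restrict_edges `<=` unordered_pairs A `*` [set: 'I_m].
Proof. exact: subIsetr. Qed.

Lemma borel_restrict_edges : borel_edge_set restrict_edges.
Proof.
move=> k.
rewrite (_ : [set p | _] =
  [set p : V * V | p.1 <> p.2 /\ edges G ([set p.1; p.2], k)] `&` (A `*` A)).
  by apply: measurableI; [exact: borel_edges | exact: measurableX].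
apply/seteqP; split => -[x y] /=.
- move=> [xy [Gxy [[[a b] /= [Aa Ab ab] abxy] _]]].
  have sub z : [set x; y] z -> A z by rewrite -abxy => -[->|->].
  by split; [|split; apply: sub; [left|right]].
- move=> [[xy Gxy] [Ax Ay]]; split=> //; split=> //; split=> //.
  by exists (x, y).
Qed.

Definition restrict : borel_multigraph A m :=
  {| edges := restrict_edges ;
     measurable_vertices := mA ;
     edges_sub := restrict_edges_sub ;
     borel_edges := borel_restrict_edges |}.

End restrict.

Section invariants.
Context (R : realType) d (V : measurableType d) (X : set V) (m : nat).
Variable G : borel_multigraph X m.

Definition degree (x : V) : \bar R := counting [set e | edges G e /\ e.1 x].

Definition max_degree : \bar R := ereal_sup [set degree x | x in X].

Definition multiplicity (s : set V) : \bar R :=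
  counting [set e | edges G e /\ e.1 = s].

(* Sets s outside [X]^2 have multiplicity 0; taking them into account makes the
   maximum 0 instead of -oo when X has fewer than two elements. *)
Definition max_multiplicity : \bar R := ereal_sup (range multiplicity).

Definition matching (M : set (edge V m)) : Prop := trivIset M fst.

(* Some of the k matchings may be empty. *)
Definition borel_matching_partition (k : nat) : Prop :=
  exists M : 'I_k -> set (edge V m),
    [/\ forall i, borel_edge_set (M i) /\ matching (M i),
        trivIset [set: 'I_k] M &
        \bigcup_i M i = edges G].

(* The smallest such k, or +oo if there is none *)
Definition borel_chromatic_index : \bar R :=
  ereal_inf [set k%:R%:E | k in borel_matching_partition].

End invariants.

Arguments max_degree R {d V X m} G.
Arguments max_multiplicity R {d V X m} G.
Arguments borel_chromatic_index R {d V X m} G.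

(* The smallest such k, or +oo if there is none *)
Definition approximate_chromatic_index (R : realType) d (V : measurableType d)
    (mu : probability V R) m (G : borel_multigraph [set: V] m) : \bar R :=
  ereal_inf [set k%:R%:E | k in [set k : nat |
    forall eps : R, (0 < eps)%R ->
      exists (A : set V) (mA : measurable A),
        mu (~` A) <= eps%:E /\
        borel_chromatic_index R (restrict G mA) <= k%:R%:E]].

(* Main.v *)
(** A Borel partial edge colouring with [Delta + pi] colours is improved along
Vizing chains, that is, a fan at an uncoloured edge followed by an alternating
path. A chain is not followed to its end: its alternating path is cut after [t]
edges, and the edge at the cut becomes uncoloured instead. Walking back from a
given edge along an alternating path shows that it is the cut of a bounded number
[K] of pairs ([t], chain), where [K] does not depend on the range of [t]. Hence,
averaging over [t < L], the new uncoloured edges have total measure at most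
[K / L], whatever the measure; this replaces the invariance of [mu].

Chains that start far apart do not interact and are used simultaneously: at each
distance, [V] is covered by countably many Borel sets of far apart vertices that
do not depend on the colouring, and finitely many of them suffice up to a small
measure. So the infimum of the measure of the uncoloured edges is [0]. Deleting
the ends of the uncoloured edges proves the theorem.

To keep everything Borel, the multi-graph is coded by countably many Borel
involutions [sigma i], the edges being the pairs [{x, sigma i x}]; they exist
because the projection of a Borel set with sections of bounded size is Borel
(Lusin and Souslin). All quantifiers over vertices near [x] are then
quantifiers over words in the [sigma i]. *)

Require Import Defs.
From HB Require Import structures.
From mathcomp Require Import all_boot all_order all_algebra.
From mathcomp Require Import all_classical all_reals all_analysis measurable_realfun.
From mathcomp Require Import ring lra.

Set Implicit Arguments.
Unset Strict Implicit.
Unset Printing Implicit Defensive.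

Import Order.TTheory GRing.Theory Num.Theory.

Local Open Scope classical_set_scope.

(** * Borel sets and their projections *)

(** As [mu] need not be invariant, the measure of the edge where an alternating path ends is not
    controlled by that of the edge where it starts. A free cut length leaves room for an average
    that only looks at the edges at the cuts. The constant [K] is [q * q * 2 * Delta * Delta]: an
    edge at a cut determines its chain once the two colours, the end of the edge reached first, the
    index leading from the start of the path to the centre of the fan and the index of the initial
    uncoloured edge are known. The length [t] need not be recorded: the start of the path misses one
    of the two colours, so the path cannot be prolonged backwards beyond it. The classes of far
    apart vertices are made disjoint, so that a chain determines its class and the bound [K] holds
    over all classes together. They are fixed before the colouring because the number of classes in
    use enters the choice of a colouring close to the infimum. No limit of colourings is taken: the
    approximate index asks for one colouring for each error. Uncoloured edges are measured by their
    darts, an index with an end, whose total measure is at most [Delta]. *)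

Section measurable_predicates.
Context d (T : measurableType d).
Implicit Types P Q : T -> Prop.

Lemma mset_not P :
  measurable [set x | P x] -> measurable [set x | ~ P x].
Proof. by move=> mP; apply: measurableC. Qed.

Lemma mset_and P Q : measurable [set x | P x] ->
  measurable [set x | Q x] -> measurable [set x | P x /\ Q x].
Proof. by move=> mP mQ; apply: measurableI. Qed.

Lemma mset_or P Q : measurable [set x | P x] ->
  measurable [set x | Q x] -> measurable [set x | P x \/ Q x].
Proof. by move=> mP mQ; apply: measurableU. Qed.

Lemma mset_const (p : Prop) : measurable [set x : T | p].
Proof.
have [h|h] := pselect p.
  rewrite (_ : [set _ | _] = setT); last by apply/seteqP; split.
  exact: measurableT.
rewrite (_ : [set _ | _] = set0); last by apply/seteqP; split.
exact: measurable0.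
Qed.

Lemma mset_imp P Q : measurable [set x | P x] ->
  measurable [set x | Q x] -> measurable [set x | P x -> Q x].
Proof.
move=> mP mQ; rewrite (_ : [set _ | _] = [set x | ~ P x \/ Q x]).
  by apply: mset_or => //; apply: mset_not.
apply/seteqP; split=> x /=; last by move=> [h|h] // /h.
by move=> h; have [/h|] := pselect (P x); [right|left].
Qed.

Lemma mset_ex (I : countType) (P : I -> T -> Prop) :
  (forall i, measurable [set x | P i x]) -> measurable [set x | exists i, P i x].
Proof.
move=> mP; rewrite (_ : [set _ | _] =
    \bigcup_n [set x | exists i, (unpickle n = Some i) /\ P i x]).
  apply: bigcupT_measurable => n; case: (unpickle n) => [i|].
    rewrite (_ : [set _ | _] = [set x | P i x]) //.
    by apply/seteqP; split=> x /= => [[j [[<-]]]|] //; exists i.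
  rewrite (_ : [set _ | _] = set0); first exact: measurable0.
  by apply/seteqP; split=> x /= => [[j []]|].
apply/seteqP; split=> x /= => [[i Pi]|[n _ [i [_ Pi]]]]; last by exists i.
by exists (pickle i) => //; exists i; rewrite pickleK.
Qed.

Lemma mset_all (I : countType) (P : I -> T -> Prop) :
  (forall i, measurable [set x | P i x]) -> measurable [set x | forall i, P i x].
Proof.
move=> mP; rewrite (_ : [set _ | _] = [set x | ~ exists i, ~ P i x]).
  by apply: mset_not; apply: mset_ex => i; apply: mset_not.
apply/seteqP; split=> x /= => [h [i]|h i]; first exact.
by apply: contrapT => hi; apply: h; exists i.
Qed.

Lemma mset_exN (I : countType) (A : I -> Prop) (P : I -> T -> Prop) :
  (forall i, A i -> measurable [set x | P i x]) ->
  measurable [set x | exists i, A i /\ P i x].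
Proof.
move=> mP; apply: mset_ex => i.
have [Ai|nAi] := pselect (A i).
  by apply: mset_and; [exact: mset_const|exact: mP].
rewrite (_ : [set _ | _] = set0); first exact: measurable0.
by apply/seteqP; split=> x // [].
Qed.

Lemma mset_allN (I : countType) (A : I -> Prop) (P : I -> T -> Prop) :
  (forall i, A i -> measurable [set x | P i x]) ->
  measurable [set x | forall i, A i -> P i x].
Proof.
move=> mP; apply: mset_all => i.
have [Ai|nAi] := pselect (A i).
  by apply: mset_imp; [exact: mset_const|exact: mP].
rewrite (_ : [set _ | _] = setT); first exact: measurableT.
by apply/seteqP; split=> x // _ /nAi.
Qed.

Lemma measurable_comp_pred d' (T' : measurableType d') (f : T' -> T) P :
  measurable_fun setT f -> measurable [set x | P x] ->
  measurable [set x | P (f x)].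
Proof. by move=> mf mP; rewrite -[X in measurable X]setTI; apply: mf. Qed.

End measurable_predicates.

(** * Borel subsets of Baire space as injective projections of closed sets *)

Definition cylinders : set (set (nat -> nat)) :=
  [set A | exists i v, A = [set z | z i = v]].

(** Only the Borel sigma-algebra is attached to Baire space; closedness is expressed by agreement of
    prefixes. *)
Notation baire := (g_sigma_algebraType cylinders).

Lemma measurable_cylinder i v : measurable [set z : baire | z i = v].
Proof. by apply: sub_sigma_algebra; exists i, v. Qed.

Lemma measurable_fun_baire d (T : measurableType d) (f : T -> baire) :
  (forall i v, measurable [set x | f x i = v]) -> measurable_fun setT f.
Proof.
move=> mf; apply: (@measurability _ _ _ baire setT f cylinders) => //.
move=> _ [_ [i [v ->]] <-]; rewrite setTI; exact: mf.
Qed.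

Lemma nat_pairing : exists (code : nat -> nat -> nat) (fst' snd' : nat -> nat),
  (forall m n, fst' (code m n) = m /\ snd' (code m n) = n) /\
  (forall k, code (fst' k) (snd' k) = k).
Proof.
have /card_set_bijP[f [_ finj fsurj]] := card_nat2.
have fi p q : f p = f q -> p = q by move=> h; apply: finj; rewrite ?in_setT.
have /choice[g gK] : forall k, exists p, f p = k.
  by move=> k; have [p _ <-] := fsurj k I; exists p.
exists (fun m n => f (m, n)), (fun k => (g k).1), (fun k => (g k).2).
split=> [m n|k]; last by rewrite -surjective_pairing.
by have -> : g (f (m, n)) = (m, n) by apply: fi; rewrite gK.
Qed.

Definition agree (C : Type) (k : nat) (u v : nat -> C) :=
  forall n, (n < k)%N -> u n = v n.

Definition closed_rel (F : (nat -> nat) -> (nat -> nat) -> Prop) :=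
  forall u z, (forall k, exists u' z', [/\ F u' z', agree k u u' & agree k z z']) ->
    F u z.

(** [A] is the injective projection of a closed subset of a product of two Baire spaces. Uniqueness
    of the witness later turns an injective map on [A] into an injective map on a closed set. *)
Definition unique_witness (A : set (nat -> nat)) :=
  exists F, [/\ closed_rel F,
    forall u, A u <-> exists z, F u z &
    forall u z z', F u z -> F u z' -> z = z'].

Lemma unique_witness_cylinder i v : unique_witness [set z | z i = v].
Proof.
exists (fun u z => u i = v /\ z = fun=> 0%N); split=> [u z h|u|u z z' [_ ->] [_ ->]//].
  split; first by have [u' [z' [[<- _] h' _]]] := h i.+1; exact: h'.
  apply/funext => n; have [u' [z' [[_ ->] _ h']]] := h n.+1.
  by apply: h'.
by split=> [?|[z []]//]; exists (fun=> 0%N).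
Qed.

Lemma unique_witness_cylinderC i v : unique_witness (~` [set z | z i = v]).
Proof.
exists (fun u z => u i <> v /\ z = fun=> 0%N); split=> [u z h|u|u z z' [_ ->] [_ ->]//].
  split; first by have [u' [z' [[h1 _] h' _]]] := h i.+1; rewrite h'.
  apply/funext => n; have [u' [z' [[_ ->] _ h']]] := h n.+1.
  by apply: h'.
by split=> [?|[z []]//]; exists (fun=> 0%N).
Qed.

Lemma ltn_bigmax (f : nat -> nat) (k n : nat) :
  (n < k)%N -> (f n < (\max_(i < k) f i).+1)%N.
Proof. by move=> nk; rewrite ltnS (leq_bigmax (Ordinal nk)). Qed.

(** One sequence stores the witnesses for all the [A n], that for [A n] in the entries [code n k].
    Since [code] is onto, no entry is left free and the witness stays unique. *)
Lemma unique_witness_bigcap (A : nat -> set (nat -> nat)) :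
  (forall n, unique_witness (A n)) -> unique_witness (\bigcap_n A n).
Proof.
move=> /choice[F FA].
have [code [f [s [codeK fsK]]]] := nat_pairing.
exists (fun u z => forall n, F n u (fun k => z (code n k))); split.
- move=> u z h n; have [cF _ _] := FA n; apply: cF => k.
  (* The prefix has to reach every entry [code n i] with [i < k]. *)
  have [u' [z' [Fu' uu' zz']]] := h (maxn k (\max_(i < k) code n i).+1).
  exists u', (fun j => z' (code n j)); split=> //.
    by move=> j jk; apply: uu'; rewrite leq_max jk.
  move=> j jk; apply: zz'; apply: leq_trans (leq_maxr _ _).
  exact: (ltn_bigmax (code n)).
- move=> u; split=> [Au|[z h] n _].
    have /choice[z Fz] : forall n, exists z, F n u z.
      by move=> n; have [_ FE _] := FA n; apply/FE; exact: Au.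
    exists (fun k => z (f k) (s k)) => n.
    rewrite (_ : (fun k => _) = z n)//; apply/funext => k.
    by have [-> ->] := codeK n k.
  by have [_ FE _] := FA n; apply/FE; exists (fun k => z (code n k)).
- move=> u z z' h h'; apply/funext => k; rewrite -(fsK k).
  have [_ _ Fu] := FA (f k).
  by have := Fu _ _ _ (h (f k)) (h' (f k)) => /(congr1 (fun g => g (s k))).
Qed.

(** The first entry of the witness names the set that contains the point; disjointness makes it
    unique. *)
Lemma unique_witness_trivIset (A : nat -> set (nat -> nat)) : trivIset setT A ->
  (forall n, unique_witness (A n)) -> unique_witness (\bigcup_n A n).
Proof.
move=> tA /choice[F FA].
exists (fun u z => F (z 0%N) u (fun k => z k.+1)); split.
- move=> u z h; have [cF _ _] := FA (z 0%N); apply: cF => k.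
  have [u' [z' [Fu' uu' zz']]] := h k.+1.
  exists u', (fun j => z' j.+1); split.
  + by rewrite zz'.
  + by move=> j jk; apply: uu'; rewrite ltnS ltnW.
  + by move=> j jk; apply: zz'.
- move=> u; split=> [[n _ An]|[z h]].
    have [_ /(_ u)[/(_ An)[z Fz] _] _] := FA n.
    by exists (fun k => if k is k'.+1 then z k' else n).
  exists (z 0%N) => //; have [_ FE _] := FA (z 0%N).
  by apply/FE; exists (fun k => z k.+1).
- move=> u z z' h h'.
  have z0 : z 0%N = z' 0%N.
    apply: (tA _ _ I I); exists u; split.
      by have [_ FE _] := FA (z 0%N); apply/FE; exists (fun k => z k.+1).
    by have [_ FE _] := FA (z' 0%N); apply/FE; exists (fun k => z' k.+1).
  rewrite -z0 in h'; have [_ _ Fu] := FA (z 0%N).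
  have E := Fu _ _ _ h h'.
  by apply/funext => -[//|k]; have := congr1 (fun g => g k) E.
Qed.

(* The complement is carried along to make countable unions disjoint. *)
Lemma borel_unique_witness (A : set baire) : measurable A -> unique_witness A.
Proof.
suff : @measurable _ baire `<=` [set A | unique_witness A /\ unique_witness (~` A)].
  by move=> h /h[].
apply: smallest_sub; last first.
  move=> _ [i [v ->]]; split; first exact: unique_witness_cylinder.
  exact: unique_witness_cylinderC.
have w0 : unique_witness set0.
  exists (fun _ _ => False); split=> //; last by move=> u; split=> // -[].
  by move=> u z /(_ 0%N)[? [? []]].
split.
- split=> //; rewrite setC0.
  exists (fun u z => z = fun=> 0%N); split=> [u z h|u|u z z' -> ->//].
    apply/funext => n; have [u' [z' [-> _ h']]] := h n.+1.
    by apply: h'.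
  by split=> // _; exists (fun=> 0%N).
- by move=> B [h1 h2]; rewrite !setTD; split=> /=; rewrite ?setCK.
move=> B mB; split; last first.
  by rewrite setC_bigcup; apply: unique_witness_bigcap => n; have [] := mB n.
rewrite seqDU_bigcup_eq; apply: unique_witness_trivIset.
  exact: trivIset_seqDU.
(* The [n]-th disjoint piece is the intersection of [B n] with the complements of the earlier sets,
   so both halves of the induction hypothesis enter. *)
move=> n; rewrite (_ : seqDU B n =
    \bigcap_m (if (m < n)%N then ~` B m else B n)).
  by apply: unique_witness_bigcap => m; case: ifP => _; have [] := mB m; have [] := mB n.
rewrite /seqDU -bigcup_mkord; apply/seteqP; split=> [x [Bn nB] m _|x h].
  by case: ifPn => // mn Bm; apply: nB; exists m.
by split=> [|[m /= mn]]; [have := h n I; rewrite ltnn|have := h m I; rewrite mn].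
Qed.

(** * Lusin separation and injective images of Borel sets *)

Definition separated_by_borel (A B : set baire) :=
  exists R : set baire, [/\ measurable R, A `<=` R & B `<=` ~` R].

(** If [R (i, j)] separates [A i] from [B j], the union over [i] of the intersections over [j] of
    the [R (i, j)] separates the unions. *)
Lemma separated_bigcup (I J : countType) (A : I -> set baire) (B : J -> set baire) :
  (forall i j, separated_by_borel (A i) (B j)) ->
  separated_by_borel (\bigcup_i A i) (\bigcup_j B j).
Proof.
move=> h; have /choice[R RP] : forall ij : I * J, exists R, [/\ measurable R,
  A ij.1 `<=` R & B ij.2 `<=` ~` R] by move=> [i j]; exact: h.
exists [set x | exists i, forall j, R (i, j) x]; split.
- apply: mset_ex => i; apply: mset_all => j.
  by have [] := RP (i, j).
- by move=> x [i _ Ax]; exists i => j; have [_ + _] := RP (i, j); exact.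
- by move=> x [j _ Bx] [i Rx]; have [_ _ /(_ x Bx)] := RP (i, j); exact.
Qed.

Definition closed_seqs (C : Type) (F : set (nat -> C)) :=
  forall w, (forall k, exists2 w', F w' & agree k w w') -> F w.

Section mkseq_facts.
Variable C : eqType.

Lemma mkseq_agree (w w' : nat -> C) k : mkseq w k = mkseq w' k -> agree k w w'.
Proof.
move=> E n nk; have := congr1 (fun s => nth (w 0%N) s n) E.
by rewrite !nth_mkseq.
Qed.

Lemma agree_mkseq (w w' : nat -> C) k : agree k w w' -> mkseq w k = mkseq w' k.
Proof.
move=> E; apply: (@eq_from_nth _ (w 0%N)); rewrite ?size_mkseq // => n nk.
by rewrite !nth_mkseq// E.
Qed.

Lemma take_mkseq (w : nat -> C) j k : (j <= k)%N -> take j (mkseq w k) = mkseq w j.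
Proof.
move=> jk; apply: (@eq_from_nth _ (w 0%N)).
  by rewrite size_takel ?size_mkseq.
rewrite size_takel ?size_mkseq // => n nj.
by rewrite nth_take// !nth_mkseq// (leq_trans nj).
Qed.

Lemma mkseqP (S : nat -> seq C) : (forall n, size (S n) = n) ->
  (forall m n, (m <= n)%N -> take m (S n) = S m) ->
  exists w : nat -> C, forall n, S n = mkseq w n.
Proof.
move=> sS tS; case E : (S 1%N) (sS 1%N) => [//|c0 l] _.
exists (fun i => nth c0 (S i.+1) i) => n.
apply: (@eq_from_nth _ c0); rewrite sS ?size_mkseq// => i ni.
by rewrite nth_mkseq// -(tS _ _ ni) nth_take.
Qed.

End mkseq_facts.

Lemma measurable_mkseq k v : measurable [set x : baire | mkseq x k = v].
Proof.
have [<-|sv] := eqVneq (size v) k; last first.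
  rewrite (_ : [set _ | _] = set0) //; apply/seteqP; split => // x /= E.
  by move: sv; rewrite -E size_mkseq eqxx.
rewrite (_ : [set _ | _] = [set x : baire | forall i, (i < size v)%N -> x i = nth 0%N v i]).
  by apply: mset_allN => i _; exact: measurable_cylinder.
apply/seteqP; split => x /= E.
  by move=> i iv; rewrite -[in RHS]E nth_mkseq.
by apply: (@eq_from_nth _ 0%N); rewrite ?size_mkseq// => i iv; rewrite nth_mkseq// E.
Qed.

Section lusin_souslin.
Variables (C : countType) (F : set (nat -> C)) (h : nat -> nat) (p : C -> nat).
Hypothesis closedF : closed_seqs F.

(** A continuous map, since each entry of [pr w] depends on a single letter of [w]. In the
    application the letters are pairs and [p] is the first projection. *)
Let pr (w : nat -> C) : nat -> nat := fun n => p (w (h n)).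
Let cone (s : seq C) : set (nat -> C) := [set w | F w /\ mkseq w (size s) = s].
Let img (s : seq C) : set baire := pr @` cone s.

Hypothesis injF : forall w w', F w -> F w' -> pr w = pr w' -> w = w'.

Let imgE s : img s = \bigcup_c img (rcons s c).
Proof.
apply/seteqP; split=> [_ [w [Fw ws] <-]|_ [c _ [w [Fw ws] <-]]].
  exists (w (size s)) => //; exists w => //; split => //.
  by rewrite size_rcons mkseqS ws.
exists w => //; split => //; move: ws; rewrite size_rcons mkseqS => /rcons_inj.
by case.
Qed.

(** If the images could not be separated, then by [separated_bigcup] neither could those of some
    one-letter extensions, and so on. The two branches obtained have limits in the closed set [F],
    distinct because [s] and [t] differ; by injectivity their images differ at some entry, and the
    cylinder at that entry separates the images of long prefixes. *)
Lemma separated_cones (s t : seq C) : size s = size t -> s <> t ->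
  separated_by_borel (img s) (img t).
Proof.
move=> sst st; apply: contrapT => nsep.
pose bad := {q : seq C * seq C | ~ separated_by_borel (img q.1) (img q.2)}.
pose next (q q' : bad) := exists c c',
  (sval q').1 = rcons (sval q).1 c /\ (sval q').2 = rcons (sval q).2 c'.
have step (q : bad) : exists q' : bad, next q q'.
  case: q => -[q1 q2] /= bq.
  have [c [c' bc]] : exists c c', ~ separated_by_borel (img (rcons q1 c)) (img (rcons q2 c')).
    apply: contrapT => nex; apply: bq; rewrite [img q1]imgE [img q2]imgE.
    apply: separated_bigcup => c c'; apply: contrapT => bc; apply: nex.
    by exists c, c'.
  by exists (exist _ (rcons q1 c, rcons q2 c') bc), c, c'.
have [S [S0 nS]] : exists S : nat -> bad, S 0%N = exist _ (s, t) nsep /\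
    forall n, next (S n) (S n.+1).
  have /choice[g gP] := step.
  by exists (fun n => iter n g (exist _ (s, t) nsep)).
pose S1 n := (sval (S n)).1; pose S2 n := (sval (S n)).2.
have E1 n : exists c, S1 n.+1 = rcons (S1 n) c.
  by have [c [c' []]] := nS n; exists c.
have E2 n : exists c, S2 n.+1 = rcons (S2 n) c.
  by have [c [c' []]] := nS n; exists c'.
have limit (U : nat -> seq C) : (forall n, exists c, U n.+1 = rcons (U n) c) ->
    exists w, forall n, U n = mkseq w (size (U 0%N) + n).
  move=> EU.
  have sU n : size (U n) = (size (U 0%N) + n)%N.
    elim: n => [|n IH]; first by rewrite addn0.
    by have [c ->] := EU n; rewrite size_rcons IH addnS.
  have [c0 _] := EU 0%N.
  have tU n i k : (i < size (U n))%N -> nth c0 (U (n + k)%N) i = nth c0 (U n) i.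
    move=> isU; elim: k => [|k IH]; first by rewrite addn0.
    have [c] := EU (n + k)%N; rewrite addnS => ->.
    by rewrite nth_rcons sU (leq_trans isU) // sU addnA leq_addr.
  exists (fun i => nth c0 (U i.+1) i) => n.
  apply: (@eq_from_nth _ c0); rewrite ?size_mkseq// => i isU.
  rewrite nth_mkseq -?sU//; have [ni|ni] := leqP n i.+1.
    by rewrite -(subnKC ni) tU.
  by rewrite -(subnKC (ltnW ni)) tU// sU addnS ltnS leq_addl.
have [w wP] := limit _ E1; have [w' w'P] := limit _ E2.
have U1 : S1 0%N = s by rewrite /S1 S0.
have U2 : S2 0%N = t by rewrite /S2 S0.
have bS n : ~ separated_by_borel (img (S1 n)) (img (S2 n)) by exact: (svalP (S n)).
have limF (U : nat -> seq C) v : (forall n, U n = mkseq v (size (U 0%N) + n)) ->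
    (forall n, img (U n) !=set0) -> F v.
  move=> vP U0; apply: closedF => k; have [_ [v' [Fv' E] _]] := U0 k.
  exists v' => //; move: E; rewrite vP size_mkseq => /esym/mkseq_agree E n nk.
  by apply: E; exact: ltn_addl.
have sep0 (A : set baire) : separated_by_borel set0 A /\ separated_by_borel A set0.
  split; first by exists set0; split => //; rewrite setC0.
  by exists setT; split => //; rewrite setCT.
have Fw : F w.
  apply: (limF S1) => // n; apply/set0P/eqP => E; apply: (bS n); rewrite E.
  by have [] := sep0 (img (S2 n)).
have Fw' : F w'.
  apply: (limF S2) => // n; apply/set0P/eqP => E; apply: (bS n); rewrite E.
  by have [] := sep0 (img (S1 n)).
have [n wn] : exists n, pr w n <> pr w' n.
  apply: contrapT => nex; apply: st; rewrite -U1 -U2 wP w'P addn0 addn0 U1 U2 sst.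
  congr mkseq; apply: injF => //; apply/funext => n.
  by apply: contrapT => nw; apply: nex; exists n.
(* At this stage the prefixes are longer than [h n], so they fix the entry [n] of the image. *)
apply: (bS (h n).+1); exists [set x : baire | x n = pr w n]; split.
- exact: measurable_cylinder.
- move=> _ [v [Fv vE] <-] /=; congr p; move: vE; rewrite wP size_mkseq.
  by move=> /mkseq_agree ->//; rewrite addnS ltnS leq_addl.
- move=> _ [v [Fv vE] <-] /= E; apply: wn; rewrite -E; congr p; move: vE.
  rewrite w'P size_mkseq => /mkseq_agree ->//; by rewrite addnS ltnS leq_addl.
Qed.

(** The topological closure of [img s]. *)
Let cl (s : seq C) : set baire :=
  [set x | forall k, exists2 w, cone s w & agree k (pr w) x].

Let measurable_cl s : measurable (cl s).
Proof.
apply: mset_all => k.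
rewrite (_ : [set _ | _] = [set x : baire | exists v : seq nat,
    (exists2 w, cone s w & mkseq (pr w) k = v) /\ mkseq x k = v]).
  by apply: mset_exN => v _; exact: measurable_mkseq.
apply/seteqP; split=> x /=.
  by move=> [w sw /agree_mkseq E]; exists (mkseq x k); split => //; exists w.
by move=> [v [[w sw <-] /esym/mkseq_agree]]; exists w.
Qed.

(** The set [B s] lies between [img s] and its closure, and by separation the [B s] with [s] of a
    given length are pairwise disjoint. Hence a point that lies in some [B s] at each length follows
    a single branch, and closedness of [F] makes this branch a preimage of the point. Disjointness
    replaces an uncountable union over branches by a countable formula. *)
Theorem lusin_souslin : measurable ((pr @` F) : set baire).
Proof.
have /choice[R RP] : forall st : seq C * seq C, exists R : set baire,
    measurable R /\ (size st.1 = size st.2 -> st.1 <> st.2 ->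
      img st.1 `<=` R /\ img st.2 `<=` ~` R).
  move=> [s t]; have [[e ne]|n] := pselect (size s = size t /\ s <> t).
    by have [R [mR R1 R2]] := separated_cones e ne; exists R.
  by exists set0; split => // e ne; case: n.
pose B s : set baire := cl s `&`
  [set x | forall t, (size t = size s /\ t <> s) -> R (s, t) x /\ ~ R (t, s) x].
have mB s : measurable (B s).
  apply: measurableI => //; apply: mset_allN => t _.
  by apply: mset_and; [|apply: mset_not]; apply: (RP (_, _)).1.
rewrite (_ : _ @` _ = [set x : baire | forall n, exists s, size s = n /\
    forall j, (j <= n)%N -> B (take j s) x]).
  apply: mset_all => n; apply: mset_exN => s _; apply: mset_allN => j _.
  exact: mB.
apply/seteqP; split=> [_ [w Fw <-] n|x xP].
  exists (mkseq w n); rewrite size_mkseq; split => // j jn; rewrite take_mkseq//.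
  have Bw : img (mkseq w j) (pr w) by exists w => //; split => //; rewrite size_mkseq.
  split; first by move=> k; exists w => //; split => //; rewrite size_mkseq.
  move=> t [e ne]; have [_ h1] := RP (mkseq w j, t); have [_ h2] := RP (t, mkseq w j).
  split; first by have [+ _] := h1 (esym e) (nesym ne); exact.
  by have [_ +] := h2 e ne; exact.
have Bu s t : size s = size t -> B s x -> B t x -> s = t.
  move=> e [_ Bs] [_ Bt]; apply: contrapT => ne.
  have [Rst _] := Bs t (conj (esym e) (nesym ne)).
  by have [_] := Bt s (conj e ne).
have /choice[S SP] := xP.
have sS n : size (S n) = n by have [] := SP n.
have BS n : B (S n) x.
  by have [_ h'] := SP n; have := h' n (leqnn n); rewrite -{1}(sS n) take_size.
have [|w wP] := mkseqP sS.
  move=> m n mn; apply: Bu => //; first by rewrite size_takel ?sS.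
  by have [_] := SP n; exact.
have cS k n : exists2 w', F w' & agree k w w' /\ agree n (pr w') x.
  have [/(_ n)[w' [Fw' E] xn] _] := BS k; exists w' => //; split=> //.
  by move: E; rewrite sS wP => /esym/mkseq_agree.
exists w; first by apply: closedF => k; have [w' Fw' []] := cS k 0%N; exists w'.
apply/funext => n; have [w' Fw' [ww' w'x]] := cS (h n).+1 n.+1.
by rewrite -w'x// /pr ww'.
Qed.

End lusin_souslin.

(** [A] is replaced by the closed set of pairs of a point of [A] and its witness, on which the map
    is still injective because witnesses are unique. *)
Lemma borel_injective_image (A : set baire) (h : nat -> nat) : measurable A ->
  (forall u v, A u -> A v -> (fun n => u (h n)) = (fun n => v (h n)) -> u = v) ->
  measurable ([set (fun n => u (h n)) | u in A] : set baire).
Proof.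
move=> /borel_unique_witness[F [cF FA Fu]] hA.
pose G : set (nat -> nat * nat) := [set w | F (fun n => (w n).1) (fun n => (w n).2)].
have GA w : G w -> A (fun n => (w n).1).
  by move=> Gw; apply/FA; exists (fun n => (w n).2).
rewrite (_ : _ @` _ = [set (fun n => (w (h n)).1) | w in G]).
  apply: (@lusin_souslin _ G h fst) => [w wG|w w' Gw Gw' /(hA _ _ (GA _ Gw) (GA _ Gw')) E].
    apply: cF => k; have [w' Gw' ww'] := wG k.
    by exists (fun n => (w' n).1), (fun n => (w' n).2); split => // n nk; rewrite ww'.
  apply/funext => n; rewrite (surjective_pairing (w n)) (surjective_pairing (w' n)).
  move: Gw' Gw; rewrite /G /= -E => Gw' Gw.
  congr pair; first exact: (congr1 (fun g => g n) E).
  exact: (congr1 (fun g => g n) (Fu _ _ _ Gw Gw')).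
apply/seteqP; split=> [_ [u /FA[z Fz] <-]|_ [w /GA Gw <-]].
  by exists (fun n => (u n, z n)).
by exists (fun n => (w n).1).
Qed.

(** * Coding of a standard Borel space in Baire space *)

Section standard_borel_coding.
Local Open Scope ring_scope.
Variables (R : realType) (T : completePseudoMetricType R) (D : set T) (t0 : T).
Hypotheses (hT : hausdorff_space T) (cD : countable D) (dD : dense D).

Let enumeration : exists e : nat -> T, forall x, D x -> exists n, e n = x.
Proof.
have /countable_injP[g ginj] := cD.
have /choice[e eP] : forall n, exists x, forall y, D y -> g y = n -> x = y.
  move=> n; have [[x [Dx gx]]|nex] := pselect (exists x, D x /\ g x = n).
    by exists x => y Dy gy; apply: ginj; rewrite ?inE// gx gy.
  by exists t0 => y Dy gy; case: nex; exists y.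
by exists e => x Dx; exists (g x); exact: eP.
Qed.

(* A countable base in which points have small neighbourhoods with closure in a
   given open set. *)
Lemma countable_regular_base : exists U : nat -> set T,
  [/\ forall a, open (U a),
      forall x (O : set T), open O -> O x ->
        exists a, U a x /\ closure (U a) `<=` O &
      forall x (e : R), 0 < e -> exists a, U a x /\ exists y, U a `<=` ball y e].
Proof.
have [e eD] := enumeration.
have [code [f [s [codeK _]]]] := nat_pairing.
pose r (k : nat) : R := k.+1%:R^-1.
have r0 k : 0 < r k by rewrite invr_gt0 ltr0n.
pose U a := (ball (e (f a)) (r (s a)))°.
have UP x k : exists a, U a x /\ s a = k.
  have rk2 : 0 < r k / 2 by rewrite divr_gt0.
  have [y [/interior_subset xy Dy]] : ((ball x (r k / 2))° `&` D) !=set0.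
    apply: dD; last exact: open_interior.
    by exists x; apply: nbhs_singleton; apply: nbhs_interior; exact: nbhsx_ballx.
  have [n en] := eD _ Dy; exists (code n k); rewrite /U; have [-> ->] := codeK n k.
  split => //; rewrite en /interior; apply/nbhs_ballP; exists (r k / 2) => //= z xz.
  by apply: (@ball_splitr _ _ x).
have small (eps : R) : 0 < eps -> exists k, r k < eps.
  move=> e0; exists (Num.bound eps^-1); rewrite /r invf_plt ?posrE//.
  by rewrite (lt_le_trans (archi_boundP _)) ?invr_ge0 ?(ltW e0)// ler_nat.
exists U; split.
- by move=> a; exact: open_interior.
- move=> x O oO Ox; have /nbhs_ballP[eps /= e0 xO] : nbhs x O by exact: open_nbhs_nbhs.
  (* A point of the closure is within [eps / 4] of a point of [U a], which is within [eps / 4] of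
     the centre; [x] is also close to the centre. *)
  have e4 : 0 < eps / 2 / 2 by rewrite !divr_gt0.
  have [k rk] := small _ e4; have [a [Ua sa]] := UP x k; exists a; split => // z cz.
  have [y [/interior_subset Uy zy]] := cz _ (nbhsx_ballx z _ e4).
  apply: xO; apply: (@ball_splitr _ _ (e (f a))).
    apply: (le_ball _ (interior_subset Ua)); rewrite sa.
    by rewrite (le_trans (ltW rk))// ler_pdivrMr// ler_peMr ?ler1n// ltW// divr_gt0.
  apply: (@ball_splitr _ _ y); last exact: ball_sym.
  by apply: ball_sym; apply: (le_ball _ Uy); rewrite sa ltW.
- move=> x eps e0; have [k rk] := small _ e0; have [a [Ua sa]] := UP x k.
  exists a; split => //; exists (e (f a)) => y /interior_subset.
  by apply: le_ball; rewrite sa ltW.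
Qed.

(** A point is coded by the characteristic sequence of the base sets that contain it. The range is
    Borel because completeness describes it by countably many conditions on the sequence. *)
Lemma polish_coding : exists phi : T -> baire, [/\ injective phi,
  forall a v, <<s @open T >> [set x | phi x a = v],
  measurable (range phi) &
  forall O, open O -> exists2 B : set baire, measurable B & O = phi @^-1` B].
Proof.
have [U [oU Ubase Usmall]] := countable_regular_base.
pose phi x : baire := fun a => if `[< U a x >] then 1%N else 0%N.
have phi1 x a : phi x a = 1%N <-> U a x.
  by rewrite /phi; case: asboolP.
exists phi; split.
- move=> x y E; apply: hT => A B Ax By.
  have [/= O [oO Ox] OA] : exists2 O, open_nbhs x O & O `<=` A by rewrite nbhsE in Ax.
  have [a [Ua cUa]] := Ubase x O oO Ox.
  exists y; split; last exact: nbhs_singleton.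
  by apply: OA; apply: cUa; apply: subset_closure; apply/phi1; rewrite -E; apply/phi1.
- move=> a v; have mU : <<s @open T >> (U a) by apply: sub_sigma_algebra; exact: oU.
  have [->|v1] := eqVneq v 1%N.
    by rewrite (_ : [set _ | _] = U a)//; apply/seteqP; split => x /phi1.
  have [->|v0] := eqVneq v 0%N.
    rewrite (_ : [set _ | _] = setT `\` U a); first exact: sigma_algebraCD.
    rewrite setTD; apply/seteqP; split => x /=; rewrite /phi; case: asboolP => //.
  rewrite (_ : [set _ | _] = set0); first exact: sigma_algebra0.
  apply/seteqP; split => // x /=; rewrite /phi; case: ifP => _ E.
    by rewrite -E in v1.
  by rewrite -E in v0.
(* The marked base sets generate a Cauchy filter, which has a limit by completeness. Any two of them
   contain the closure of a third, so the limit lies in each marked set; upward closure marks every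
   base set around the limit. *)
- pose filt (z : baire) := [/\
    (forall a, z a = 0%N \/ z a = 1%N) /\ (forall a, z a = 1%N -> U a !=set0),
    forall k, exists a, (exists y, U a `<=` ball y (k.+1%:R^-1)) /\ z a = 1%N,
    forall a b, z a = 1%N /\ z b = 1%N ->
      exists c, closure (U c) `<=` U a `&` U b /\ z c = 1%N &
    forall a b, U a `<=` U b -> z a = 1%N -> z b = 1%N].
  rewrite (_ : range phi = [set z | filt z]).
    rewrite /filt; rewrite (_ : [set _ | _] = [set z : baire |
      ((forall a, z a = 0%N \/ z a = 1%N) /\ (forall a, z a = 1%N -> U a !=set0)) /\
      ((forall k, exists a, (exists y, U a `<=` ball y (k.+1%:R^-1)) /\ z a = 1%N) /\
      ((forall a b, z a = 1%N /\ z b = 1%N ->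
      exists c, closure (U c) `<=` U a `&` U b /\ z c = 1%N) /\
      (forall a b, U a `<=` U b -> z a = 1%N -> z b = 1%N)))]); last first.
      by apply/seteqP; split=> z /=; [move=> []|move=> [? [? []]]].
    repeat apply: mset_and.
    + by apply: mset_all => a; apply: mset_or; exact: measurable_cylinder.
    + apply: mset_all => a; apply: mset_imp; first exact: measurable_cylinder.
      exact: mset_const.
    + apply: mset_all => k; apply: mset_ex => a.
      by apply: mset_and; [exact: mset_const|exact: measurable_cylinder].
    + apply: mset_all => a; apply: mset_all => b; apply: mset_imp.
        by apply: mset_and; exact: measurable_cylinder.
      apply: mset_ex => c.
      by apply: mset_and; [exact: mset_const|exact: measurable_cylinder].
    + apply: mset_all => a; apply: mset_all => b; apply: mset_imp.
        exact: mset_const.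
      by apply: mset_imp; exact: measurable_cylinder.
  apply/seteqP; split=> [_ [x _ <-]|z].
    split.
    + split=> a; first by rewrite /phi; case: ifP; [right|left].
      by move=> /phi1 Ux; exists x.
    + move=> k; have [|a [Ua sa]] := Usmall x (k.+1%:R^-1).
        by rewrite invr_gt0 ltr0n.
      by exists a; split => //; apply/phi1.
    + move=> a b [/phi1 Ua /phi1 Ub].
      have [|c [Uc cUc]] := Ubase x _ (openI (oU a) (oU b)); first by split.
      by exists c; split => //; apply/phi1.
    + by move=> a b ab /phi1 Ua; apply/phi1; exact: ab.
  move=> [[z01 zU] zs zc zm].
  pose FF := filter_from [set a | z a = 1%N] U.
  have fF : Filter FF.
    apply: filter_from_filter; first by have [a [_ za]] := zs 0%N; exists a.
    move=> a b za zb; have [c [cU zc1]] := zc a b (conj za zb).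
    by exists c => //; apply: subset_trans cU; exact: subset_closure.
  have pF : ProperFilter FF.
    by apply: filter_from_proper => a /zU.
  have /cauchy_cvg/cvg_ex[x Fx] : cauchy FF.
    apply: cauchy_exP => eps e0.
    have [a [[y ay] za]] := zs (Num.bound eps^-1); exists y, a => //.
    apply: (subset_trans ay); apply: le_ball.
    rewrite invf_ple ?posrE ?ltr0n//.
    by rewrite ltW// (lt_le_trans (archi_boundP _)) ?invr_ge0 ?(ltW e0)// ler_nat.
  exists x => //; apply/funext => a.
  have Uz : U a x -> z a = 1%N.
    move=> Ua; have [b zb ba] : FF (U a) by apply: Fx; exact: open_nbhs_nbhs.
    exact: (zm b a).
  have zUx : z a = 1%N -> U a x.
    move=> za; have [c [cU zc1]] := zc a a (conj za za).
    suff : closure (U c) x by move/cU => [].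
    move=> B /Fx[b zb bB]; have [e [eU ze]] := zc b c (conj zb zc1).
    have [y Uy] := zU e ze; exists y.
    by have [/bB By Uc] := eU _ (subset_closure Uy).
  rewrite /phi; case: asboolP => [/Uz ->//|nU].
  by have [->//|/zUx] := z01 a.
- move=> O oO; exists [set z : baire | exists a, U a `<=` O /\ z a = 1%N].
    by apply: mset_exN => a _; exact: measurable_cylinder.
  apply/seteqP; split=> x /=.
    move=> Ox; have [a [Ua cU]] := Ubase x O oO Ox; exists a; split; last exact/phi1.
    by apply: subset_trans cU; exact: subset_closure.
  by move=> [a [aO /phi1 /aO]].
Qed.

End standard_borel_coding.

Lemma standard_borel_coding (R : realType) d (V : measurableType d) :
  standard_borel R V -> exists phi : V -> baire, [/\ injective phi,
    measurable_fun setT phi, measurable (range phi) &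
    forall A, measurable A -> exists2 B : set baire, measurable B & A = phi @^-1` B].
Proof.
move=> [T [f [hT [D cD dD] [_ finj fsurj] mf]]].
have fi : injective f by move=> x y; apply: finj; rewrite in_setT.
have fs y : exists x, f x = y by have [x _ <-] := fsurj y I; exists x.
have [psi [psiI mpsi mrange psiO]] := @polish_coding R T D (f point) hT cD dD.
have fimg (P : set T) : f @` (f @^-1` P) = P.
  apply/seteqP; split=> [_ [x Px <-]//|y Py].
  by have [x fx] := fs y; exists x => //=; rewrite fx.
have fpre A : f @^-1` (f @` A) = A.
  by apply/seteqP; split=> [x [y Ay /fi <-]//|x Ax]; exists x.
exists (psi \o f); split.
- by move=> x y /psiI /fi.
- apply: measurable_fun_baire => i v; apply/mf.
  by rewrite (_ : _ @` _ = [set y | psi y i = v])//; exact: (fimg [set y | psi y i = v]).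
- rewrite (_ : range _ = range psi)//; apply/seteqP; split=> [_ [x _ <-]|_ [y _ <-]].
    by exists (f x).
  by have [x <-] := fs y; exists x.
- move=> A /mf mA.
  suff [B mB E] : exists2 B : set baire, measurable B & f @` A = psi @^-1` B.
    by exists B => //; rewrite -[LHS]fpre E.
  move: (f @` A) mA => {}A.
  move: A; apply: smallest_sub; last by move=> O /psiO.
  split.
  + by exists set0; [exact: measurable0|rewrite preimage_set0].
  + move=> A [B mB ->]; exists (~` B); first exact: measurableC.
    by rewrite setTD preimage_setC.
  + move=> A mA; have /choice[B BP] : forall n, exists B : set baire,
        measurable B /\ A n = psi @^-1` B by move=> n; have [B] := mA n; exists B.
    exists (\bigcup_n B n); first by apply: bigcupT_measurable => n; have [] := BP n.
    by rewrite preimage_bigcup; apply: eq_bigcupr => n _; have [] := BP n.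
Qed.

(** * Projections of Borel sets with sections of bounded size *)

Section coded_space.
Context d (V : measurableType d) (phi : V -> baire).
Hypotheses (phiI : injective phi) (mphi : measurable_fun setT phi)
  (mrange : measurable (range phi))
  (phiE : forall A, measurable A ->
    exists2 B : set baire, measurable B & A = phi @^-1` B).

Lemma measurable_coded2 (E : set (V * V)) : measurable E ->
  exists B : set (baire * baire), [/\ measurable B,
    forall x y, B (phi x, phi y) <-> E (x, y) &
    forall u, B u -> range phi u.1 /\ range phi u.2].
Proof.
move=> mE; suff [B mB BE] : exists2 B : set (baire * baire), measurable B &
    forall x y, B (phi x, phi y) <-> E (x, y).
  exists (B `&` (range phi `*` range phi)); split.
  - by apply: measurableI => //; exact: measurableX.
  - by move=> x y; rewrite -BE; split=> [[]//|h]; split.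
  - by move=> u [_ []].
move: E mE; rewrite measurable_prod_measurableType; apply: smallest_sub; last first.
  move=> _ [A mA [C mC <-]].
  have [A' mA' ->] := phiE mA; have [C' mC' ->] := phiE mC.
  by exists (A' `*` C') => //; exact: measurableX.
split.
- by exists set0 => //; exact: measurable0.
- move=> A [B mB BE]; exists (~` B); first exact: measurableC.
  by move=> x y; rewrite setTD /setC /= BE.
- move=> A mA; have /choice[B BP] : forall n, exists B : set (baire * baire),
      measurable B /\ forall x y, B (phi x, phi y) <-> A n (x, y).
    by move=> n; have [B] := mA n; exists B.
  exists (\bigcup_n B n); first by apply: bigcupT_measurable => n; have [] := BP n.
  by move=> x y; split=> -[n _]; have [_ BE] := BP n; move=> /BE h; exists n.
Qed.

Let prefix k x := mkseq (phi x) k.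

Lemma prefixes_differ (s : seq V) : exists k,
  forall x y, x \in s -> y \in s -> prefix k x = prefix k y -> x = y.
Proof.
have diff (x y : V) : exists k, forall k', (k <= k')%N -> prefix k' x = prefix k' y -> x = y.
  have [->|/eqP xy] := eqVneq x y; first by exists 0%N.
  have [n xyn] : exists n, phi x n <> phi y n.
    apply: contrapT => nex; apply: xy; apply: phiI; apply/funext => n.
    by apply: contrapT => h; apply: nex; exists n.
  by exists n.+1 => k' nk' /mkseq_agree /(_ n nk').
have /choice[K KP] : forall xy : V * V, exists k, forall k', (k <= k')%N ->
  prefix k' xy.1 = prefix k' xy.2 -> xy.1 = xy.2 by move=> [x y]; exact: diff.
exists (\max_(x <- s) \max_(y <- s) K (x, y)) => x y xs ys.
apply: (KP (x, y)); apply: leq_trans (leq_bigmax_seq _ xs isT).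
exact: (@leq_bigmax_seq _ s xpredT (fun y => K (x, y)) y ys isT).
Qed.

Lemma measurable_prefix k v : measurable [set x | prefix k x = v].
Proof.
apply: (@measurable_comp_pred _ _ _ _ phi (fun z => mkseq z k = v)) => //.
exact: measurable_mkseq.
Qed.

(* The points with a neighbour in each of the given cylinders: the tuples of
   neighbours are unique when there are as many cylinders as possible. *)
Let full_fiber (E : set (V * V)) n k (ss : seq (seq nat)) : set V :=
  [set x | forall i, (i < n)%N -> exists y, E (x, y) /\ prefix k y = nth [::] ss i].

Let measurable_full_fiber (E : set (V * V)) n k ss : measurable E -> uniq ss ->
  size ss = n.+1 ->
  (forall x s, uniq s -> (forall y, y \in s -> E (x, y)) -> (size s <= n.+1)%N) ->
  measurable (full_fiber E n.+1 k ss).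
Proof.
move=> mE uss sss En; have [B [mB BE Brange]] := measurable_coded2 mE.
have [code [f [s [codeK fsK]]]] := nat_pairing.
pose row (u : baire) j : baire := fun m => u (code j m).
have mrow j : measurable_fun setT (row^~ j).
  by apply: measurable_fun_baire => i v; exact: measurable_cylinder.
(* Row [0] codes [x] and the next [n + 1] rows code neighbours in the prescribed cylinders. The
   remaining rows are set to [0], so that keeping only row [0] can be injective. *)
pose A : set baire := [set u |
  (forall i, (i < n.+1)%N -> B (row u 0%N, row u i.+1) /\ mkseq (row u i.+1) k = nth [::] ss i) /\
  (forall i, (n < i)%N -> forall m, row u i.+1 m = 0%N)].
have mA : measurable A.
  apply: mset_and.
    apply: mset_allN => i _; apply: mset_and.
      apply: (@measurable_comp_pred _ _ _ _ (fun u => (row u 0%N, row u i.+1)) B) => //.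
      exact: measurable_fun_pair.
    apply: (@measurable_comp_pred _ _ _ _ (row^~ i.+1) (fun z => mkseq z k = nth [::] ss i)) => //.
    exact: measurable_mkseq.
  apply: mset_allN => i _; apply: mset_all => m.
  apply: (@measurable_comp_pred _ _ _ _ (row^~ i.+1) (fun z => z m = 0%N)) => //.
  exact: measurable_cylinder.
have AE u : A u -> exists x (ys : nat -> V), row u 0%N = phi x /\ forall i, (i < n.+1)%N ->
    [/\ row u i.+1 = phi (ys i), E (x, ys i) & prefix k (ys i) = nth [::] ss i].
  move=> [Au _]; have [/Brange[/= [x _ xu] _] _] := Au 0%N isT.
  exists x; have /choice[ys ysP] : forall i, exists y, (i < n.+1)%N ->
      [/\ row u i.+1 = phi y, E (x, y) & prefix k y = nth [::] ss i].
    move=> i; have [iN|] := boolP (i < n.+1)%N; last by exists x.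
    have [Bi mi] := Au i iN; have [_ /= [y _ yu]] := Brange _ Bi.
    exists y => _; split => //; last by rewrite /prefix yu.
    by apply/BE; rewrite xu yu.
  by exists ys; split.
rewrite (_ : full_fiber _ _ _ _ =
    phi @^-1` [set (fun m => u (code 0%N m)) | u in A]); last first.
  apply/seteqP; split=> [x /= xP|x /= [u Au E1]].
    have /choice[y yP] : forall i, exists y, (i < n.+1)%N ->
        E (x, y) /\ prefix k y = nth [::] ss i.
      move=> i; have [iN|] := boolP (i < n.+1)%N; last by exists x.
      by have [y] := xP i iN; exists y.
    pose u : baire := fun m => if f m is j.+1 then
      if (j < n.+1)%N then phi (y j) (s m) else 0%N else phi x (s m).
    have u0 : row u 0%N = phi x.
      by apply/funext => m; rewrite /row /u; have [-> ->] := codeK 0%N m.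
    have uS i : (i < n.+1)%N -> row u i.+1 = phi (y i).
      move=> iN; apply/funext => m; rewrite /row /u.
      by have [-> ->] := codeK i.+1 m; rewrite iN.
    exists u; last exact: u0.
    split=> i iN; first by rewrite u0 uS// BE; exact: yP.
    move=> m; rewrite /row /u; have [-> ->] := codeK i.+1 m.
    by rewrite ltnS leqNgt iN.
  have [x' [ys [x'u ysP]]] := AE u Au; move: E1; rewrite -/(row u 0%N) x'u => /phiI <-.
  by move=> i iN; exists (ys i); have [] := ysP i iN.
rewrite -[X in measurable X]setTI; apply: mphi => //; apply: borel_injective_image => //.
move=> u v Au Av E1.
have [x [ys [xu ysP]]] := AE u Au; have [x' [zs [x'v zsP]]] := AE v Av.
have xx' : x' = x by apply: phiI; rewrite -xu -x'v; apply/esym.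
rewrite {x'}xx' in x'v zsP.
(* A second neighbour in the same cylinder would make [n + 2] distinct neighbours of [x]. *)
have yz i : (i < n.+1)%N -> ys i = zs i.
  move=> iN; apply: contrapT => yzi.
  suff : (size (ys i :: mkseq zs n.+1) <= n.+1)%N.
    by rewrite -[size _]/((size (mkseq zs n.+1)).+1) size_mkseq ltnn.
  apply: (En x) => [|y].
    have uz : uniq [seq prefix k y | y <- mkseq zs n.+1].
      rewrite (_ : [seq _ | _ <- _] = ss)//; apply: (@eq_from_nth _ [::]).
        by rewrite size_map size_mkseq sss.
      rewrite size_map size_mkseq => j jn.
      by rewrite (nth_map (zs 0%N)) ?size_mkseq// nth_mkseq//; have [] := zsP j jn.
    rewrite cons_uniq (map_uniq uz) andbT; apply/negP => /mapP[j].
    rewrite mem_iota add0n => /andP[_ jn] yj; apply: yzi.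
    have [_ _ p1] := ysP i iN; have [_ _ p2] := zsP j jn.
    move: p1; rewrite yj p2 => /eqP; rewrite nth_uniq ?sss// => /eqP ji.
    by rewrite ji.
  rewrite in_cons => /predU1P[->|/mapP[j]]; first by have [] := ysP i iN.
  by rewrite mem_iota add0n => /andP[_ jn] ->; have [] := zsP j jn.
have rows j : row u j = row v j.
  case: j => [|i]; first by rewrite xu x'v.
  have [iN|iN] := ltnP i n.+1.
    by have [-> _ _] := ysP i iN; have [-> _ _] := zsP i iN; rewrite yz.
  by apply/funext => m; have [_ ->//] := Au; have [_ ->] := Av.
by apply/funext => m; rewrite -(fsK m); exact: (congr1 (fun r => r (s m)) (rows (f m))).
Qed.

(** Induction on the bound: the points whose section has the maximal size [n + 1] form a Borel set,
    a countable union of sets [full_fiber], and outside it the sections have size at most [n]. *)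
Lemma measurable_projection (E : set (V * V)) n : measurable E ->
  (forall x s, uniq s -> (forall y, y \in s -> E (x, y)) -> (size s <= n)%N) ->
  measurable [set x | exists y, E (x, y)].
Proof.
elim: n E => [|n IH] E mE En.
  rewrite (_ : [set _ | _] = set0) //; apply/seteqP; split => // x [y Exy].
  have := En x [:: y] isT; rewrite /= ltn0 => h.
  by have : false by apply: h => z; rewrite inE => /eqP ->.
pose D : set V := [set x | exists kss : nat * seq (seq nat),
  (uniq kss.2 /\ size kss.2 = n.+1) /\ full_fiber E n.+1 kss.1 kss.2 x].
have mD : measurable D.
  by apply: mset_exN => -[k ss] [uss sss]; exact: measurable_full_fiber.
pose E' : set (V * V) := [set p | ~ D p.1 /\ E p].
have mE' : measurable E'.
  apply: mset_and => //; apply: mset_not.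
  exact: (measurable_comp_pred (f := fst)).
rewrite (_ : [set _ | _] = [set x | D x \/ exists y, E' (x, y)]).
  apply: mset_or => //; apply: IH => // x s us sE.
  have sE' y : y \in s -> E (x, y) by move=> /sE [].
  have := En x s us sE'; rewrite leq_eqVlt => /orP[/eqP sn|]; last by rewrite ltnS.
  have [k kI] := prefixes_differ s.
  have [nD _] : E' (x, head x s) by apply: sE; case: s sn {us sE' kI} => //= *; rewrite mem_head.
  case: nD; exists (k, [seq prefix k y | y <- s]); split.
    by rewrite /= size_map map_inj_in_uniq.
  move=> i iN; exists (nth x s i); split; first by apply: sE'; rewrite mem_nth ?sn.
  by rewrite (nth_map x) ?sn.
apply/seteqP; split=> x /=.
  by move=> [y Exy]; have [Dx|nDx] := pselect (D x); [left|right; exists y].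
move=> [[[k ss] [_ /(_ 0%N isT)[y [Exy _]]]]|[y [_ Exy]]]; by exists y.
Qed.

End coded_space.

(** * Decomposition of a bounded degree graph into matchings *)

Lemma bounded_finite (T : eqType) (P : T -> Prop) n :
  (forall s, uniq s -> (forall y, y \in s -> P y) -> (size s <= n)%N) ->
  exists s, [/\ uniq s, (size s <= n)%N & forall y, y \in s <-> P y].
Proof.
elim: n => [|n IH] Pn.
  exists [::]; split => // y; split => // Py.
  suff : (size [:: y] <= 0)%N by [].
  by apply: Pn => // z; rewrite inE => /eqP ->.
have [[s [us sP sn]]|nex] := pselect (exists s : seq T,
    [/\ uniq s, forall y, y \in s -> P y & size s = n.+1]).
  exists s; split => //; first by rewrite sn.
  move=> y; split; first exact: sP.
  move=> Py; apply: contrapT => /negP ys.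
  suff : (size (y :: s) <= n.+1)%N by rewrite /= sn ltnn.
  apply: Pn => [|z]; first by rewrite /= ys.
  by rewrite inE => /predU1P[->//|/sP].
have [|s [us sn sP]] := IH.
  move=> s us sP; have := Pn s us sP; rewrite leq_eqVlt => /predU1P[sn|]; last by rewrite ltnS.
  by case: nex; exists s.
by exists s; split => //; exact: leqW.
Qed.

Section matching_decomposition.
Context d (V : measurableType d) (phi : V -> baire).
Hypotheses (phiI : injective phi) (mphi : measurable_fun setT phi)
  (mrange : measurable (range phi))
  (phiE : forall A, measurable A ->
    exists2 B : set baire, measurable B & A = phi @^-1` B).
Variables (E : set (V * V)) (n : nat).
Hypotheses (mE : measurable E) (Esym : forall x y, E (x, y) -> E (y, x))
  (Eirr : forall x, ~ E (x, x))
  (En : forall x s, uniq s -> (forall y, y \in s -> E (x, y)) -> (size s <= n)%N).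

Let in_cyl s x := mkseq (phi x) (size s) = s.

Let m_in_cyl s : measurable [set x | in_cyl s x].
Proof. exact: measurable_prefix. Qed.

Let mfst (P : V -> Prop) : measurable [set x | P x] ->
  measurable [set p : V * V | P p.1].
Proof. exact: (@measurable_comp_pred _ _ _ _ fst P). Qed.

Let msnd (P : V -> Prop) : measurable [set x | P x] ->
  measurable [set p : V * V | P p.2].
Proof. exact: (@measurable_comp_pred _ _ _ _ snd P). Qed.

Let mproj (F : set (V * V)) : measurable F -> F `<=` E ->
  measurable [set x | exists y, F (x, y)].
Proof.
move=> mF FE; apply: (measurable_projection phiI mphi mrange phiE (n := n)) => //.
by move=> x s us sF; apply: (@En x s us) => y /sF /FE.
Qed.

(** At least two neighbours of [x] lie in the cylinder [t]. Telling them apart by prefixes leaves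
    only projections of subsets of [E] under a countable quantifier. *)
Let crowded t x := exists s1s2 : seq nat * seq nat,
  (size s1s2.1 = size s1s2.2 /\ s1s2.1 <> s1s2.2) /\
  ((exists y, E (x, y) /\ (in_cyl t y /\ in_cyl s1s2.1 y)) /\
   (exists y, E (x, y) /\ (in_cyl t y /\ in_cyl s1s2.2 y))).

Let m_crowded t : measurable [set x | crowded t x].
Proof.
apply: mset_exN => -[s1 s2] _ /=; apply: mset_and.
  apply: (mproj (F := [set p | E p /\ (in_cyl t p.2 /\ in_cyl s1 p.2)])); last by move=> p [].
  by apply: mset_and => //; apply: mset_and; apply: msnd.
apply: (mproj (F := [set p | E p /\ (in_cyl t p.2 /\ in_cyl s2 p.2)])); last by move=> p [].
by apply: mset_and => //; apply: mset_and; apply: msnd.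
all: by apply: mset_and => //; apply: mset_and; apply: msnd.
Qed.

Let ncrowdedP t x y y' : ~ crowded t x -> E (x, y) -> in_cyl t y ->
  E (x, y') -> in_cyl t y' -> y = y'.
Proof.
move=> nc Ey ty Ey' ty'; apply: contrapT => /eqP yy'; apply: nc.
have [k kI] := prefixes_differ phiI [:: y; y'].
have kyy' : mkseq (phi y) k <> mkseq (phi y') k.
  by move=> /kI; rewrite !inE !eqxx orbT => /(_ isT isT)/eqP; rewrite (negbTE yy').
exists (mkseq (phi y) k, mkseq (phi y') k); rewrite /= /in_cyl !size_mkseq; split => //.
by split; [exists y|exists y'].
Qed.

(** For an edge from [x] to [y], [y] is the only neighbour of [x] in the second cylinder and [x] the
    only neighbour of [y] in the first. The cylinders are disjoint, so no vertex plays both roles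
    and the edges that fit form a matching. *)
Let fits (st : seq nat * seq nat) x y := [/\ size st.1 = size st.2, st.1 <> st.2,
  in_cyl st.1 x /\ in_cyl st.2 y & ~ crowded st.2 x /\ ~ crowded st.1 y].

Let pairing i (p : V * V) := exists st, unpickle i = Some st /\
  (E p /\ (fits st p.1 p.2 \/ fits st p.2 p.1)).

Let m_pairing i : measurable [set p | pairing i p].
Proof.
apply: mset_exN => -[s t] _; apply: mset_and => //; rewrite /fits /=.
have mfits : measurable [set p : V * V | fits (s, t) p.1 p.2].
  rewrite (_ : [set _ | _] = [set p : V * V | (size s = size t /\ s <> t) /\
    ((in_cyl s p.1 /\ in_cyl t p.2) /\ (~ crowded t p.1 /\ ~ crowded s p.2))]).
    apply: mset_and; first exact: mset_const.
    apply: mset_and; apply: mset_and.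
    - exact: (mfst (m_in_cyl s)).
    - exact: (msnd (m_in_cyl t)).
    - exact: (mfst (mset_not (m_crowded t))).
    - exact: (msnd (mset_not (m_crowded s))).
  by apply/seteqP; split=> p; [move=> []|move=> [[? ?] [? ?]]; split].
apply: mset_or; first exact: mfits.
apply: (@measurable_comp_pred _ _ _ _ (fun p : V * V => (p.2, p.1))
  (fun p => fits (s, t) p.1 p.2)) => //.
by apply: measurable_fun_pair; [exact: measurable_snd|exact: measurable_fst].
Qed.

Let pairing_sym i x y : pairing i (x, y) -> pairing i (y, x).
Proof.
by move=> [st [ist [Exy h]]]; exists st; split => //; split; [exact: Esym|case: h; [right|left]].
Qed.

Let pairing_uniq i x y y' : pairing i (x, y) -> pairing i (x, y') -> y = y'.
Proof.
move=> [[s t] [ist [Exy h]]] [[s' t'] []]; rewrite ist => -[<- <-] [Exy' h'].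
move: h h' => [[/= st nst [sx ty] [c _]]|[/= st nst [sy tx] [_ c]]].
  move=> [[/= _ _ [_ ty'] _]|[/= _ _ [_ tx] _]]; first exact: ncrowdedP c Exy ty Exy' ty'.
  by case: nst; rewrite -sx -tx st.
move=> [[/= _ _ [sx _] _]|[/= _ _ [sy' _] _]]; last exact: ncrowdedP c Exy sy Exy' sy'.
by case: nst; rewrite -sx -tx st.
Qed.

Let pairing_cover x y : E (x, y) -> exists i, pairing i (x, y).
Proof.
move=> Exy.
have [sx [_ _ sxP]] := bounded_finite (@En x).
have [sy [_ _ syP]] := bounded_finite (@En y).
(* Prefixes of this length distinguish [x], [y] and all their neighbours, so neither end of the edge
   is crowded. *)
have [k kI] := prefixes_differ phiI (x :: y :: sx ++ sy).
pose s := mkseq (phi x) k; pose t := mkseq (phi y) k.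
have xy : x <> y by move=> xy; move: Exy; rewrite xy; exact: Eirr.
have nc u v (l : seq V) : E (u, v) -> (forall w, w \in l <-> E (u, w)) ->
    {subset l <= x :: y :: sx ++ sy} -> ~ crowded (mkseq (phi v) k) u.
  move=> Euv lP ll [[s1 s2] /= [[ss1 ss2] [[y1 [/lP ly1 [ty1 sy1]]] [y2 [/lP ly2 [ty2 sy2]]]]]].
  have /lP lv := Euv; apply: ss2; rewrite -sy1 -sy2 ss1; congr (mkseq (phi _) _).
  move: ty1 ty2; rewrite /in_cyl size_mkseq => ty1 ty2.
  by rewrite (kI y1 v (ll _ ly1) (ll _ lv) ty1) (kI y2 v (ll _ ly2) (ll _ lv) ty2).
exists (pickle (s, t)), (s, t); split; first by rewrite pickleK.
split => //; left; split; rewrite /in_cyl ?size_mkseq //.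
- by move=> /kI; rewrite !inE !eqxx orbT => /(_ isT isT).
- split; rewrite /= /s /t.
    by apply: (nc x y sx Exy sxP) => w ws; rewrite !inE mem_cat ws !orbT.
  by apply: (nc y x sy (Esym Exy) syP) => w ws; rewrite !inE mem_cat ws !orbT.
Qed.

(** Each edge is kept only in the first matching that contains it, so that it gets a single
    index. *)
Let first_pairing i (p : V * V) := pairing i p /\ forall j, (j < i)%N -> ~ pairing j p.

Let m_first_pairing i : measurable [set p | first_pairing i p].
Proof.
apply: mset_and; first exact: m_pairing.
by apply: mset_allN => j _; apply: mset_not; exact: m_pairing.
Qed.

Let first_pairing_sym i x y : first_pairing i (x, y) -> first_pairing i (y, x).
Proof. by move=> [h nh]; split=> [|j ji /pairing_sym]; [exact: pairing_sym|exact: nh]. Qed.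

(** The default value makes the unmatched vertices fixed points. *)
Let sigma i x := xget x [set y | first_pairing i (x, y)].

Let sigmaP i x y : first_pairing i (x, y) -> sigma i x = y.
Proof.
move=> h; apply: xget_unique => // y' [h' _].
exact: (pairing_uniq h' (proj1 h)).
Qed.

Let sigma_neq i x : sigma i x <> x -> first_pairing i (x, sigma i x).
Proof. by rewrite /sigma; case: xgetP => [y -> //|]. Qed.

Lemma matching_decomposition : exists sigma : nat -> V -> V, [/\
  forall i, measurable_fun setT (sigma i),
  forall i x, sigma i (sigma i x) = x,
  forall i x, sigma i x <> x -> E (x, sigma i x),
  forall x y, E (x, y) -> exists i, sigma i x = y &
  forall i j x, sigma i x <> x -> sigma i x = sigma j x -> i = j].
Proof.
exists sigma; split.
- move=> i _ B mB; rewrite setTI (_ : _ @^-1` _ = [set x |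
    (exists y, first_pairing i (x, y) /\ B y) \/
    (~ (exists y, first_pairing i (x, y)) /\ B x)]).
    apply: mset_or; [|apply: mset_and; [apply: mset_not|exact: mB]].
      apply: (mproj (F := [set p | first_pairing i p /\ B p.2])); last first.
        by move=> p [[[st [_ [Ep _]]] _] _].
      by apply: mset_and; [exact: m_first_pairing|exact: (msnd (P := B))].
    by apply: (mproj (F := first_pairing i)); [exact: m_first_pairing|move=> p [[st [_ [Ep _]]] _]].
  apply/seteqP; split=> x /=.
    have [[y xy]|nex] := pselect (exists y, first_pairing i (x, y)).
      by rewrite (sigmaP xy) => By; left; exists y.
    by rewrite /sigma xgetPN => [Bx|y xy]; [right|apply: nex; exists y].
  move=> [[y [xy By]]|[nex Bx]]; first by rewrite (sigmaP xy).
  by rewrite /sigma xgetPN// => y xy; apply: nex; exists y.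
- move=> i x; have [e|ne] := pselect (sigma i x = x); first by rewrite !e.
  exact: (sigmaP (first_pairing_sym (sigma_neq ne))).
- by move=> i x ne; have [[st [_ [Ep _]]] _] := sigma_neq ne.
- move=> x y /pairing_cover h.
  have hb : exists i, `[< pairing i (x, y) >] by have [i hi] := h; exists i; exact/asboolP.
  exists (ex_minn hb); case: ex_minnP => i /asboolP hi imin.
  apply: sigmaP; split => // j ji /asboolP/imin; by rewrite leqNgt ji.
- move=> i j x xi E1; have hj : sigma j x <> x by rewrite -E1.
  have [p1 m1] := sigma_neq xi; have [p2 m2] := sigma_neq hj.
  rewrite -E1 in p2 m2; have [ij|ji|//] := ltngtP i j.
    by have := m2 i ij p1.
  by have := m1 j ji p2.
Qed.

End matching_decomposition.

(** * Truncated Vizing chains *)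

(** An orbit of two involutions has at most two ends: [x], fixed by [f], is one, so the ends [y] and
    [z], fixed by [g], coincide. In terms of [r = g \o f] and [m = l - k], [y] is [r^m z], while
    both [r^(2m)] and [r^(2l+1)] fix [z]; as [m (2l + 1) = m + l (2m)], so does [r^m]. *)
Lemma dihedral_fixed (T : Type) (f g : T -> T) x y z k l :
  involutive f -> involutive g -> f x = x -> g y = y -> g z = z ->
  iter k (g \o f) y = x -> iter l (g \o f) z = x -> y = z.
Proof.
move=> fK gK fx gy gz.
wlog kl : k l y z gy gz / (k <= l)%N.
  move=> h yx zx; have [kl|/ltnW lk] := leqP k l; first exact: (h k l).
  by apply/esym; exact: (h l k).
pose r := g \o f; pose r' := f \o g.
have rK n w : iter n r' (iter n r w) = w.
  by elim: n w => // n IH w; rewrite iterSr /= /r' /= gK fK IH.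
have r'K n w : iter n r (iter n r' w) = w.
  by elim: n w => // n IH w; rewrite iterSr /= /r /= fK gK IH.
have gr n w : g (iter n r w) = iter n r' (g w).
  by elim: n => //= n <-; rewrite /r' /r /= !gK.
move=> yx zx; pose m := (l - k)%N.
have ym : y = iter m r z.
  have e : iter k r y = iter k r (iter m r z) by rewrite -iterD subnKC// /r yx zx.
  by rewrite -(rK k y) e rK.
have zm : iter m r (iter m r z) = z.
  have : g y = iter m r' z by rewrite ym gr gz.
  by rewrite gy -ym => h; rewrite [in LHS]h r'K.
have zo : iter l.*2.+1 r z = z.
  have e : iter l r' z = iter l.+1 r z.
    by rewrite -{1}gz -gr zx iterS zx /r /= fx.
  by rewrite -addnn -addnS iterD -e r'K.
have zmm n : iter (n * (m + m)) r z = z.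
  by elim: n => // n IH; rewrite mulSn iterD IH iterD.
have : iter (m * l.*2.+1) r z = z.
  by elim: m {ym zm zmm} => // n IH; rewrite mulSn iterD IH.
have -> : (m * l.*2.+1 = m + l * (m + m))%N.
  by rewrite mulnS addnn -!muln2 mulnCA.
by rewrite iterD zmm -ym.
Qed.

(** * Partial edge colourings and shifting of fans *)

Section vizing.
Variables (V : choiceType) (sigma : nat -> V -> V) (q : nat).
Hypothesis sigmaK : forall i, involutive (sigma i).

(** [c i x] is read at the dart [(i, x)]. In a proper colouring it is also [None] at fixed points of
    [sigma i], where there is no edge; hence the first condition in [uncolored]. *)
Definition coloring := nat -> V -> option 'I_q.

Definition proper (c : coloring) := [/\ forall i x, c i (sigma i x) = c i x,
  forall i x a, c i x = Some a -> sigma i x <> x &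
  forall i j x a, c i x = Some a -> c j x = Some a -> i = j].

Definition missing (c : coloring) a x := forall i, c i x <> Some a.

Definition uncolored (c : coloring) i x := sigma i x <> x /\ c i x = None.

Definition same_edge i x j y := i = j /\ (y = x \/ y = sigma i x).

Definition recolor (c : coloring) i x (v : option 'I_q) : coloring := fun j y =>
  if (j == i) && ((y == x) || (y == sigma i x)) then v else c j y.

Lemma recolorP c i x v j y : same_edge i x j y -> recolor c i x v j y = v.
Proof.
by move=> [<-]; rewrite /recolor eqxx => -[->|->]; rewrite eqxx ?orbT.
Qed.

Lemma recolorN c i x v j y : ~ same_edge i x j y -> recolor c i x v j y = c j y.
Proof.
move=> h; rewrite /recolor; case: ifP => // /andP[/eqP ji /orP[] /eqP yx].
- by case: h; split => //; left.
- by case: h; split => //; right.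
Qed.

Lemma same_edge_sigma i x j y : same_edge i x j y <-> same_edge i x j (sigma j y).
Proof.
suff h z : same_edge i x j z -> same_edge i x j (sigma j z).
  by split=> [/h//|/h]; rewrite sigmaK.
by move=> [<- [->|->]]; split => //; [right|left; rewrite sigmaK].
Qed.

Lemma proper_recolor c i x a : proper c -> sigma i x <> x -> missing c a x ->
  missing c a (sigma i x) -> proper (recolor c i x (Some a)).
Proof.
move=> [cs cd cp] ix ax asx; split.
- move=> j y; have [h|h] := pselect (same_edge i x j y).
    by rewrite !recolorP//; apply/same_edge_sigma; rewrite sigmaK.
  by rewrite !recolorN// => /same_edge_sigma; rewrite ?sigmaK// => /same_edge_sigma.
- move=> j y b; have [h _|h] := pselect (same_edge i x j y).
    by case: h => <- [->//|->]; rewrite sigmaK => /esym.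
  by rewrite recolorN//; exact: cd.
- have am j y : same_edge i x j y -> missing c a y by move=> [_ [->|->]].
  move=> j k y b.
  have [hj|hj] := pselect (same_edge i x j y); have [hk|hk] := pselect (same_edge i x k y).
  + by case: hj => <- _; case: hk => <-.
  + by rewrite recolorP// recolorN// => -[<-] /(am _ _ hj).
  + by rewrite recolorN// recolorP// => + [ab]; rewrite -ab => /(am _ _ hk).
  + by rewrite !recolorN//; exact: cp.
Qed.

Lemma missing_recolor c i x a b y : missing c b y -> b <> a ->
  missing (recolor c i x (Some a)) b y.
Proof.
move=> h ba j; have [hj|hj] := pselect (same_edge i x j y).
  by rewrite recolorP// => -[] /esym.
by rewrite recolorN.
Qed.

Lemma uncolored_recolor c i x a j y : uncolored (recolor c i x (Some a)) j y ->
  uncolored c j y /\ ~ same_edge i x j y.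
Proof.
move=> [jy]; have [hj|hj] := pselect (same_edge i x j y); first by rewrite recolorP.
by rewrite recolorN.
Qed.

(** The successor relation of Vizing fans centred at [x]. *)
Definition link (c : coloring) x : rel nat := fun i j =>
  `[< exists a, missing c a (sigma i x) /\ c j x = Some a >].

(* The fan is shifted from its end, so that the colouring stays proper at each
   step: the last edge takes the colour [a] and releases its own. *)
Lemma shift_fan x i0 p (c : coloring) a : proper c -> uncolored c i0 x ->
  path (link c x) i0 p -> uniq (i0 :: p) -> missing c a x ->
  missing c a (sigma (last i0 p) x) ->
  exists c', [/\ proper c', forall j y, c' j y <> c j y -> y = x \/ y = sigma j x &
    forall j y, uncolored c' j y -> uncolored c j y /\ ~ same_edge i0 x j y].
Proof.
elim/last_ind: p c a => [|p r IH] c a okc u0 pp up ax al.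
  exists (recolor c i0 x (Some a)); split.
  - by apply: proper_recolor => //; case: u0.
  - move=> j y; have [[<-]//|h] := pselect (same_edge i0 x j y); by rewrite recolorN.
  - by move=> j y /uncolored_recolor.
move: pp; rewrite rcons_path => /andP[pp /asboolP[b [bl br]]].
rewrite last_rcons in al.
have [cs cd cp] := okc; have rx := cd _ _ _ br.
have ba : b <> a by move=> ba; rewrite ba in br; exact: (ax r).
have ok' := proper_recolor okc rx ax al.
move: up; rewrite -rcons_cons rcons_uniq => /andP[rp up].
have r0 : i0 <> r by move=> E; move: rp; rewrite E mem_head.
have rr : same_edge r x r x by split; [|left].
have [|||||c' [ok'' c'c uc']] := IH (recolor c r x (Some a)) b ok'.
- split; first by case: u0.
  by rewrite recolorN => [|[/esym//]]; case: u0.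
- apply: (@sub_in_path _ [pred i | i != r] (link c x)) pp; last first.
    by apply/allP => i ip /=; apply: contraNneq rp => <-.
  move=> i j _ /= jr /asboolP[e [ei ej]]; apply/asboolP; exists e; split.
    by apply: missing_recolor => // ea; rewrite ea in ej; exact: (ax j).
  by rewrite recolorN// => -[rj]; rewrite inE rj eqxx in jr.
- exact: up.
- move=> j; have [hj|hj] := pselect (same_edge r x j x).
    by rewrite recolorP// => -[] /esym.
  by rewrite recolorN// => h; apply: hj; have <- := cp _ _ _ _ br h; split; [|left].
- exact: missing_recolor.
exists c'; split => //.
- move=> j y; have [[<-]//|h] := pselect (same_edge r x j y).
  by have := c'c j y; rewrite recolorN.
- by move=> j y /uc' [/uncolored_recolor[]].
Qed.

(** * Kempe changes along truncated alternating paths *)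

Definition swap_color (a b e : 'I_q) := if e == a then b else if e == b then a else e.

(** A Kempe change inside an arbitrary set [Q] of vertices. The edges of colours [a] and [b] that
    leave [Q] lose their colour, which keeps the colouring proper; this is how a path is cut. *)
Definition swap_on (c : coloring) (Q : pred V) (a b : 'I_q) : coloring := fun i x =>
  if c i x is Some e then
    if ((e == a) || (e == b)) && (Q x != Q (sigma i x)) then None
    else Some (if Q x then swap_color a b e else e)
  else None.

Lemma swap_colorK a b : involutive (swap_color a b).
Proof.
move=> e; rewrite /swap_color; have [->|ea] := eqVneq e a.
  by have [->|_] := eqVneq b a; rewrite ?eqxx.
have [->|eb] := eqVneq e b; first by rewrite eqxx.
by rewrite (negbTE ea) (negbTE eb).
Qed.

Lemma swap_on_some c Q a b i x e : swap_on c Q a b i x = Some e ->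
  c i x = Some (if Q x then swap_color a b e else e).
Proof.
rewrite /swap_on; case: (c i x) => // e'; case: ifP => // _ [<-].
by case: (Q x); rewrite ?swap_colorK.
Qed.

Lemma proper_swap_on c Q a b : proper c -> proper (swap_on c Q a b).
Proof.
move=> [cs cd cp]; split.
- move=> i x; rewrite /swap_on cs; case: (c i x) => // e.
  rewrite sigmaK (eq_sym (Q (sigma i x))); case: ifP => // /negbT.
  rewrite negb_and negbK.
  case/orP => [|/eqP -> //]; rewrite negb_or => /andP[ea eb].
  by rewrite /swap_color (negbTE ea) (negbTE eb); do 2!case: ifP.
- by move=> i x e /swap_on_some /cd.
- by move=> i j x e /swap_on_some h /swap_on_some h'; exact: cp h h'.
Qed.

Lemma missing_swap_on c Q a b e x : missing c e x -> e <> a ->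
  missing (swap_on c Q a b) e x \/ missing (swap_on c Q a b) a x.
Proof.
move=> ex ea; have [Qx|nQx] := boolP (Q x).
  have [eb|eb] := eqVneq e b.
    right=> i /swap_on_some; rewrite Qx /swap_color eqxx -eb => h.
    exact: (ex i).
  left=> i /swap_on_some; rewrite Qx /swap_color (negbTE eb).
  by case: eqP => // _; exact: ex.
by left=> i /swap_on_some; rewrite (negbTE nQx); exact: ex.
Qed.

Lemma missing_swap_onQ c (Q : pred V) a b x : missing c b x -> Q x ->
  missing (swap_on c Q a b) a x.
Proof.
by move=> bx Qx i /swap_on_some; rewrite Qx /swap_color eqxx; exact: bx.
Qed.

Lemma swap_on_id c (Q : pred V) a b i x : missing c a x -> ~~ Q x ->
  (c i x = Some b -> ~~ Q (sigma i x)) -> swap_on c Q a b i x = c i x.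
Proof.
move=> ax Qx Qb; rewrite /swap_on; case E : (c i x) => [e|//].
have [ea|ea] := eqVneq e a; first by rewrite ea in E; case: (ax i).
have [eb|//] := eqVneq e b; last by rewrite (negbTE Qx).
by rewrite (negbTE Qx) (negbTE (Qb _)) // E eb.
Qed.

(** The matching of colour [e] as an involution that fixes the vertices missing [e]. The default
    index [0] is discarded by the test. *)
Definition nbr (c : coloring) (e : 'I_q) (v : V) : V :=
  let i := xget 0%N [set i | c i v = Some e] in
  if c i v == Some e then sigma i v else v.

Lemma nbrP c e i v : proper c -> c i v = Some e -> nbr c e v = sigma i v.
Proof.
move=> [_ _ cp] h; rewrite /nbr; have /= h' := @xgetI _ 0%N [set i | c i v = Some e] _ h.
by rewrite h' eqxx (cp _ _ _ _ h h').
Qed.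

Lemma nbr_missing c e v : missing c e v -> nbr c e v = v.
Proof. by rewrite /nbr => h; case: eqP => // /h. Qed.

Lemma nbr_neq c e v : nbr c e v <> v ->
  exists i, c i v = Some e /\ nbr c e v = sigma i v.
Proof. by rewrite /nbr; case: eqP => // h _; eexists; split; [exact: h|]. Qed.

Lemma nbrK c e : proper c -> involutive (nbr c e).
Proof.
move=> ok v; have [h|/nbr_neq[i [ci ->]]] := pselect (nbr c e v = v).
  by rewrite !h.
have [cs _ _] := ok; by rewrite (@nbrP c e i) ?sigmaK ?cs.
Qed.

(** At a dead end the sequence pauses for one step and then walks back; this is why paths are
    required not to stall up to the cut. *)
Fixpoint alternate (c : coloring) (a b : 'I_q) y t := if t is t'.+1 then
  nbr c (if odd t' then b else a) (alternate c a b y t') else y.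

Lemma alternate_double c a b y k :
  alternate c a b y k.*2 = iter k (nbr c b \o nbr c a) y.
Proof. by elim: k => // k IH; rewrite doubleS /= odd_double /= IH. Qed.

(* The dart [(i, v)] belongs to the edge [v_t v_(t+1)] of the alternating path
   [v_0 v_1 ...] that starts at a neighbour [v_0] of [x]. *)
Definition path_edge c t x i v := exists a b y, [/\ a <> b,
  y <> x /\ exists k, sigma k y = x, missing c b y,
  forall k, (k <= t)%N -> alternate c a b y k.+1 <> alternate c a b y k &
  exists u, [/\ u = alternate c a b y t, c i u = Some (if odd t then b else a) &
    v = u \/ v = sigma i u]].

Lemma alternate_back c a b y y' t k : proper c ->
  alternate c a b y t = alternate c a b y' (t + k) -> ~~ odd k ->
  y = alternate c a b y' k.
Proof.
move=> ok; elim: t => [|t IH] //= + ek => /(congr1 (nbr c (if odd t then b else a))).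
rewrite oddD (negbTE ek) addbF !nbrK//; by move/IH; exact.
Qed.

(* The start of an alternating path is missing [b], so a path of even positive
   length that reaches it has stalled one step before. *)
Lemma alternate_start c a b y y' t t' : proper c -> missing c b y -> missing c b y' ->
  (forall k, (k <= t)%N -> alternate c a b y k.+1 <> alternate c a b y k) ->
  (forall k, (k <= t')%N -> alternate c a b y' k.+1 <> alternate c a b y' k) ->
  odd t = odd t' -> alternate c a b y t = alternate c a b y' t' -> t = t' /\ y = y'.
Proof.
move=> ok; wlog tt' : t t' y y' / (t <= t')%N.
  move=> h by_ by' hy hy' ot E; have [tt'|/ltnW tt'] := leqP t t'; first exact: h.
  by have [-> ->] := h t' t y' y tt' by' by_ hy' hy (esym ot) (esym E).
move=> by_ by' _ hy' ot E; pose m := (t' - t)%N.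
have em : ~~ odd m by rewrite oddB// ot addbb.
have ym : y = alternate c a b y' m by apply: (@alternate_back c a b y y' t); rewrite ?subnKC.
case Em : m em ym => [|k] /=; rewrite ?negbK.
  move=> _ ->; split => //; apply/eqP; rewrite eqn_leq tt' /=.
  by rewrite -subn_eq0; apply/eqP.
move=> ok'; rewrite ok' => ym; exfalso; apply: (hy' k).
  by rewrite -ltnS -Em; apply: leq_trans (leq_subr t t') _.
rewrite /= ok' -ym; have : nbr c b y = alternate c a b y' k.
  by rewrite ym nbrK.
by rewrite nbr_missing.
Qed.

Definition act (w : seq nat) x := foldl (fun y i => sigma i y) x w.

Lemma alternate_act c a b y t :
  exists2 w, (size w <= t)%N & alternate c a b y t = act w y.
Proof.
elim: t => [|t [w wt E]]; first by exists [::].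
have [h|/nbr_neq[i [_ h]]] := pselect
  (nbr c (if odd t then b else a) (alternate c a b y t) = alternate c a b y t).
  by exists w; [exact: leqW|rewrite /= h].
by exists (rcons w i); rewrite ?size_rcons// /= h E /act foldl_rcons.
Qed.

(** At the first fan end that no longer misses the colour of its link, the new colouring misses [a],
    and the fan can stop there. *)
Lemma fan_persists (c c1 : coloring) x a p i0 : (forall j, c1 j x = c j x) ->
  (forall b y, missing c b y -> b <> a -> missing c1 b y \/ missing c1 a y) ->
  missing c a x -> path (link c x) i0 p -> missing c1 a (sigma (last i0 p) x) ->
  exists p', path (link c1 x) i0 p' /\ missing c1 a (sigma (last i0 p') x).
Proof.
move=> cx cm ax; elim: p i0 => [|j p IH] i0 /=; first by exists [::].
move=> /andP[/asboolP[b [bi bj]] pp] al.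
have [//|p' [pp' al']] := IH j pp.
have ba : b <> a by move=> E; rewrite E in bj; exact: (ax j).
have [bi'|ai'] := cm _ _ bi ba; last by exists [::].
by exists (j :: p'); split => //=; rewrite pp' andbT; apply/asboolP; exists b; rewrite cx.
Qed.

(** [Q] consists of the vertices of the path up to step [t]. The edges of colours [a] and [b] at
    these vertices join consecutive vertices of the path, except the next edge at its last vertex;
    the start has no edge of colour [b]. *)
Lemma alternate_boundary c a b y t (Q : pred V) i v e : proper c -> missing c b y ->
  (forall u, Q u <-> exists2 r, (r <= t)%N & u = alternate c a b y r) ->
  c i v = Some e -> (e == a) || (e == b) -> Q v -> ~~ Q (sigma i v) ->
  [/\ v = alternate c a b y t, e = (if odd t then b else a) &
      alternate c a b y t.+1 <> alternate c a b y t].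
Proof.
move=> ok by_ QP ce eab Qv nQ.
have nQs r : (r <= t)%N -> alternate c a b y r <> sigma i v.
  by move=> rt E; move/negP: nQ; apply; apply/QP; exists r.
have /QP[r rt vr] := Qv.
have en := nbrP ok ce.
have er : e = (if odd r then b else a).
  apply: contrapT => er; have {er} er : e = (if odd r then a else b).
    by move: er; case/orP: eab => /eqP ->; case: (odd r).
  case: r => [|r] in rt vr er *; first by move: ce; rewrite er vr => /by_.
  apply: (nQs r); first exact: ltnW.
  rewrite -en vr /= er /=; have -> : (if ~~ odd r then a else b) = if odd r then b else a.
    by case: (odd r).
  by rewrite nbrK.
have E : alternate c a b y r.+1 = sigma i v by rewrite /= -er -vr en.
have rt' : r = t.
  apply/eqP; rewrite eqn_leq rt leqNgt; apply/negP => rt'.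
  exact: (nQs r.+1).
subst r; split => //; rewrite E -vr; have [_ cd _] := ok; exact: cd ce.
Qed.

(** * One truncated Vizing chain, and the number of chains with a given cut *)

Section degree.
Variables (Delta mult : nat) (darts : V -> seq nat).
Hypotheses
  (dartsP : forall x i, i \in darts x <-> sigma i x <> x)
  (size_darts : forall x, (size (darts x) <= Delta)%N)
  (count_darts : forall x y, y <> x ->
    (count (fun i => sigma i x == y) (darts x) <= mult)%N)
  (qE : (Delta + mult <= q)%N).

Let miss c x : {set 'I_q} := [set a | `[< missing c a x >]]%SET.

(** At most [Delta] of the [Delta + mult] or more colours are present at a vertex. *)
Let card_miss c x : proper c -> (mult <= #|miss c x|)%N.
Proof.
move=> [_ cd _]; rewrite -(leq_add2l #|~: miss c x|) [X in (_ <= X)%N]addnC cardsC card_ord.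
apply: leq_trans qE; rewrite leq_add2r; apply: leq_trans (size_darts x).
have sub : ~: miss c x \subset [set a in pmap (c^~ x) (darts x)]%SET.
  apply/fintype.subsetP => a; rewrite !inE => /asboolPn na.
  have [i ci] : exists i, c i x = Some a.
    by apply: contrapT => h; apply: na => i ci; apply: h; exists i.
  rewrite mem_pmap; apply/mapP; exists i => //; apply/dartsP; exact: cd ci.
apply: leq_trans (subset_leq_card sub) _; rewrite cardsE.
by apply: leq_trans (card_size _) _; rewrite size_pmap count_size.
Qed.

Let sum_card_disjoint (T : eqType) (M : T -> {set 'I_q}) (s : seq T) (l : seq 'I_q) :
  uniq s ->
  (forall x y a, x \in s -> y \in s -> a \in M x -> a \in M y -> x = y) ->
  (forall x a, x \in s -> a \in M x -> a \in l) ->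
  (\sum_(x <- s) #|M x| <= size l)%N.
Proof.
move=> us dM sM.
have -> : (\sum_(x <- s) #|M x| = \sum_(a : 'I_q) count (fun x => a \in M x) s)%N.
  under eq_bigr do rewrite -sum1_card big_mkcond /=.
  rewrite exchange_big /=; apply: eq_bigr => a _.
  by rewrite -sum1_count [RHS]big_mkcond.
apply: leq_trans (card_size l); rewrite -sum1_card [X in (_ <= X)%N]big_mkcond /=.
apply: leq_sum => a _.
have [/hasP[x xs ax]|] := boolP (has (fun x => a \in M x) s); last first.
  by rewrite has_count -leqNgt leqn0 => /eqP ->.
rewrite (sM x a)// (@eq_in_count _ _ (pred1 x)) ?count_uniq_mem ?xs//.
by move=> y ys /=; apply/idP/eqP => [ay|->//]; exact: (dM _ _ a).
Qed.

Let sum_count_undup (T S : eqType) (f : T -> S) (s : seq T) :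
  (\sum_(y <- undup (map f s)) count (fun i => f i == y) s = size s)%N.
Proof.
under eq_bigr do rewrite -sum1_count big_mkcond /=.
rewrite exchange_big /= -sum1_size !big_seq; apply: eq_bigr => i si.
rewrite -big_mkcond sum1_count (@eq_count _ _ (pred1 (f i))); last first.
  by move=> y; rewrite /= eq_sym.
by rewrite count_uniq_mem ?undup_uniq// mem_undup map_f.
Qed.

Let fan c x i0 i := exists p, path (link c x) i0 p /\ last i0 p = i.

Let fan_dart c x i0 i : proper c -> uncolored c i0 x -> fan c x i0 i -> sigma i x <> x.
Proof.
move=> [_ cd _] [u0 _] [p [+ <-]]; case/lastP: p => // p j.
by rewrite rcons_path last_rcons => /andP[_ /asboolP[a [_ /cd]]].
Qed.

(* Either [x] and the end of a fan edge, or the distinct ends of two fan edges,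
   miss a common colour: otherwise the missing sets of the ends would be disjoint,
   and their colours, all present at [x] by maximality of the fan, would be more
   numerous than the coloured edges of the fan. *)
Let fan_common c x i0 : proper c -> uncolored c i0 x ->
  (exists i a, [/\ fan c x i0 i, missing c a x & missing c a (sigma i x)]) \/
  (exists i j b, [/\ fan c x i0 i, fan c x i0 j, sigma i x <> sigma j x,
     missing c b (sigma i x) & missing c b (sigma j x)]).
Proof.
move=> ok u0; apply: contrapT => /not_orP[na nb].
pose F := [seq i <- darts x | `[< fan c x i0 i >]].
have FP i : i \in F <-> fan c x i0 i.
  rewrite mem_filter; split=> [/andP[/asboolP]//|h].
  by apply/andP; split; [exact/asboolP|apply/dartsP; exact: fan_dart h].
have F0 : i0 \in F by apply/FP; exists [::].
pose Y := undup [seq sigma i x | i <- F].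
pose L := pmap (c^~ x) F.
have YP y : y \in Y -> exists2 i, fan c x i0 i & y = sigma i x.
  by rewrite mem_undup => /mapP[i /FP fi ->]; exists i.
have h1 : (\sum_(y <- Y) #|miss c y| <= size L)%N.
  apply: sum_card_disjoint; first exact: undup_uniq.
    move=> y z a /YP[i fi ->] /YP[j fj ->]; rewrite !inE => /asboolP ai /asboolP aj.
    apply: contrapT => ij; apply: nb; exists i, j, a; split => //; exact: asboolW.
  move=> y a /YP[i fi ->]; rewrite inE => /asboolW ai.
  have [j cj] : exists j, c j x = Some a.
    apply: contrapT => h; apply: na; exists i, a; split => // j cj.
    by apply: h; exists j.
  rewrite mem_pmap; apply/mapP; exists j => //; apply/FP.
  have [p [pp pi]] := fi; exists (rcons p j); rewrite rcons_path last_rcons pp pi.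
  by split => //; apply/asboolP; exists a.
have h2 : (size L < size F)%N.
  rewrite size_pmap -(count_predC (fun i => isSome (c i x)) F) -[X in (X < _)%N]addn0.
  rewrite ltn_add2l -has_count; apply/hasP; exists i0 => //=.
  by case: u0 => _ ->.
(* At most [mult] edges of the fan end at a given [y], which misses at least [mult] colours. *)
have h3 : (size F <= \sum_(y <- Y) #|miss c y|)%N.
  rewrite -(sum_count_undup (fun i => sigma i x) F) -/Y big_seq [X in (_ <= X)%N]big_seq.
  apply: leq_sum => y /YP[i fi ->]; apply: leq_trans (card_miss _ ok).
  apply: leq_trans (count_darts (fan_dart ok u0 fi)).
  by rewrite count_filter; apply: sub_count => j /= /andP[].
by move: (leq_trans h2 (leq_trans h3 h1)); rewrite ltnn.
Qed.

(** If [x] and a fan end miss a common colour, the fan is shifted. Otherwise [x] misses some [a] and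
    two fan ends miss a common [b]; swapping [a] and [b] along the path from one of them, up to step
    [t], makes that end miss [a], and the fan is then shifted. The edge at the cut is the only one
    to lose its colour. *)
Lemma vizing_step t c x i0 : proper c -> uncolored c i0 x -> exists c', [/\ proper c',
  forall j y, c' j y <> c j y -> exists2 w, (size w <= t.+2)%N & y = act w x &
  forall j y, uncolored c' j y ->
    (uncolored c j y /\ ~ same_edge i0 x j y) \/ path_edge c t x j y].
Proof.
move=> ok u0.
have finish c1 a p : proper c1 -> uncolored c1 i0 x -> path (link c1 x) i0 p ->
    missing c1 a x -> missing c1 a (sigma (last i0 p) x) ->
    exists c', [/\ proper c',
      forall j y, c' j y <> c1 j y -> exists2 w, (size w <= t.+2)%N & y = act w x &
      forall j y, uncolored c' j y -> uncolored c1 j y /\ ~ same_edge i0 x j y].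
  move=> ok1 u1 pp ax; case/shortenP: pp => p' pp' up' _ al.
  have [c' [ok' cc' uc']] := shift_fan ok1 u1 pp' up' ax al.
  exists c'; split => // j y /cc'[->|->]; first by exists [::].
  by exists [:: j].
have [[i [a [[p [pp pi]] ax ai]]]|[i [j [b [fi fj ij bi bj]]]]] := fan_common ok u0.
  have [|c' [ok' cc' uc']] := finish c a p ok u0 pp ax; first by rewrite pi.
  by exists c'; split => // k y /uc'; left.
have [a ax] : exists a, missing c a x.
  have : (0 < #|miss c x|)%N.
    (* The bound [mult] is positive because it counts the uncoloured edge [i0] itself. *)
    apply: leq_trans (card_miss x ok).
    have [u0x _] := u0; apply: leq_trans (count_darts u0x).
    by rewrite -has_count; apply/hasP; exists i0 => //; apply/dartsP.
  by rewrite card_gt0 => /finset.set0Pn[a]; rewrite inE => /asboolW; exists a.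
have [ab|/eqP ab] := eqVneq a b.
  rewrite -ab in bi; have [p [pp pi]] := fi.
  have [|c' [ok' cc' uc']] := finish c a p ok u0 pp ax; first by rewrite pi.
  by exists c'; split => // k y /uc'; left.
(* By [dihedral_fixed], the alternating paths from the two distinct fan ends cannot both reach [x],
   which misses [a]. *)
wlog nhit : i j fi fj ij bi bj / forall r, alternate c a b (sigma i x) r <> x.
  move=> h; have [hi|/existsNP[r /contrapT hr]] :=
    pselect (forall r, alternate c a b (sigma i x) r <> x).
    exact: (h i j).
  apply: (h j i) => //; first exact: nesym.
  move=> r' hr'; apply: ij.
  have hit y s : alternate c a b y s = x -> exists k, iter k (nbr c b \o nbr c a) y = x.
    rewrite -(odd_double_half s); case: (odd s) => /=; rewrite ?add0n ?add1n.
      rewrite /= odd_double => E; exists s./2; rewrite -alternate_double.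
      by rewrite -[LHS](nbrK a ok) E nbr_missing.
    by rewrite alternate_double; exists s./2.
  have [k hk] := hit _ _ hr; have [l hl] := hit _ _ hr'.
  by apply: (dihedral_fixed (nbrK a ok) (nbrK b ok) _ _ _ hk hl); exact: nbr_missing.
set y0 := sigma i x in bi nhit.
(* If the path stalls by step [t], it is swapped entirely and no edge is cut. *)
have [s [st sP]] : exists s, (s <= t)%N /\
    ((alternate c a b y0 s.+1 = alternate c a b y0 s) \/
     (s = t /\ forall k, (k <= t)%N -> alternate c a b y0 k.+1 <> alternate c a b y0 k)).
  have [[s st sE]|h] := pselect (exists2 s, (s <= t)%N &
      alternate c a b y0 s.+1 = alternate c a b y0 s).
    by exists s; split => //; left.
  by exists t; split => //; right; split => // k kt E; apply: h; exists k.
pose Q : pred V := fun v => v \in [seq alternate c a b y0 r | r <- iota 0 s.+1].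
have QP v : Q v <-> exists2 r, (r <= s)%N & v = alternate c a b y0 r.
  rewrite /Q; split=> [/mapP[r]|[r rs ->]].
    by rewrite mem_iota add0n ltnS => rs ->; exists r.
  by apply/mapP; exists r => //; rewrite mem_iota add0n ltnS.
have Qx : ~~ Q x by apply/negP => /QP[r _ /esym]; exact: nhit.
pose c1 := swap_on c Q a b.
have ok1 : proper c1 by exact: proper_swap_on.
have c1x k : c1 k x = c k x.
  apply: swap_on_id => // ck; apply/negP => /QP[r _ E].
  have xE : x = nbr c b (alternate c a b y0 r) by rewrite -E -(nbrP ok ck) nbrK.
  case: r xE {E} => [|r] xE.
    by apply: (nhit 0%N); rewrite xE /= nbr_missing.
  case er : (odd r) xE => xE.
    by apply: (nhit r); rewrite xE /= er nbrK.
  by apply: (nhit r.+2); rewrite [RHS]xE /= er.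
have [p [pp pi]] := fi.
have b_y0 : missing c b y0 := bi.
have c1al : missing c1 a (sigma (last i0 p) x).
  by rewrite pi; apply: missing_swap_onQ => //; apply/QP; exists 0%N.
have [p' [pp' al']] := fan_persists c1x (fun e y => @missing_swap_on c Q a b e y) ax pp c1al.
have u1 : uncolored c1 i0 x by case: u0 => u0x u0c; split => //; rewrite c1x.
have a1x : missing c1 a x by move=> k; rewrite c1x.
have [c' [ok' cc' uc']] := finish c1 a p' ok1 u1 pp' a1x al'.
exists c'; split => //.
(* One letter leads from [x] to [y0], at most [t] letters follow the path, and a last one reaches
   the other end of an edge that leaves [Q]. *)
- have near y : Q y -> exists2 w, (size w <= t.+1)%N & y = act w x.
    move=> /QP[r rs ->]; have [w wr ->] := alternate_act c a b y0 r.
    by exists (i :: w) => //=; exact: leq_trans wr (leq_trans rs st).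
  move=> k y kk; have [E|E] := pselect (c' k y = c1 k y); last exact: (cc' k).
  have [/near[w wt yw]|nQy] := boolP (Q y); first by exists w => //; exact: leqW.
  have [/near[w wt yw]|nQy'] := boolP (Q (sigma k y)).
    exists (rcons w k); first by rewrite size_rcons.
    by rewrite /act foldl_rcons -/(act w x) -yw sigmaK.
  case: kk; rewrite E /c1 /swap_on (negbTE nQy) (negbTE nQy').
  by case: (c k y) => // e; rewrite eqxx andbF.
- move=> k y /uc'[[ky c1N] nsame].
  case E : (c k y) => [e|]; last by left.
  right; have : c1 k y = None by [].
  rewrite /c1 /swap_on E; case: ifP => // /andP[eab Qy] _.
  have pe v : v = y \/ v = sigma k y -> Q v -> ~~ Q (sigma k v) -> path_edge c t x k y.
    move=> vy Qv nQv; have [cs _ _] := ok.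
    have cv : c k v = Some e by case: vy => ->; rewrite ?cs.
    have [vs eE nst] := alternate_boundary ok b_y0 QP cv eab Qv nQv.
    case: sP => [//|[ss nstall]]; rewrite ss in vs eE.
    exists a, b, y0; split => //.
      split; last by exists i; exact: sigmaK.
      by apply: fan_dart fi.
    exists v; split => //; first by rewrite cv eE.
    by case: vy => ->; [left|right; rewrite sigmaK].
  have [Q1|Q1] := boolP (Q y).
    by apply: (pe y) => //; [left|move: Qy; rewrite Q1; case: (Q (sigma k y))].
  apply: (pe (sigma k y)); first by right.
    by move: Qy; rewrite (negbTE Q1); case: (Q (sigma k y)).
  by rewrite sigmaK.
Qed.

(** The factors count the colours [a] and [b], the end of the given edge reached first, the position
    of an index from the start [y] to the centre, and the position of [k j] at the centre. By
    [alternate_start] these data also determine [t j] and [y], hence the bound does not involve the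
    lengths. *)
Lemma count_path_edges (c : coloring) i v (J : finType) (S : {set J}) (t : J -> nat)
    (x : J -> V) (k : J -> nat) : proper c ->
  (forall j, j \in S -> path_edge c (t j) (x j) i v /\ sigma (k j) (x j) <> x j) ->
  (forall j j', j \in S -> j' \in S -> t j = t j' -> x j = x j' -> k j = k j' -> j = j') ->
  (#|S| <= q * q * 2 * Delta * Delta)%N.
Proof.
move=> ok SP Sinj.
pose data := ('I_q * 'I_q * bool * 'I_Delta * 'I_Delta)%type.
pose coded (D : data) j := let: (a, b, h, m, n) := D in exists y,
  [/\ a <> b /\ missing c b y,
    forall k, (k <= t j)%N -> alternate c a b y k.+1 <> alternate c a b y k,
    (if h then v else sigma i v) = alternate c a b y (t j) /\
    c i (if h then v else sigma i v) = Some (if odd (t j) then b else a),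
    x j = sigma (nth 0%N (darts y) m) y & k j = nth 0%N (darts (x j)) n].
have position y l : sigma l y <> y -> exists m : 'I_Delta, l = nth 0%N (darts y) m.
  move=> /dartsP ly; have lt : (index l (darts y) < Delta)%N.
    by apply: leq_trans (size_darts y); rewrite index_mem.
  by exists (Ordinal lt); rewrite /= nth_index.
have /choice[f fP] : forall j, exists o : option data,
    j \in S -> exists2 D, o = Some D & coded D j.
  move=> j; have [jS|jS] := boolP (j \in S); last by exists None.
  have [[a [b [y [ab [yx [l lx]] by_ nst [u [uE cu vu]]]]]] kx] := SP j jS.
  have [m mE] : exists m : 'I_Delta, l = nth 0%N (darts y) m.
    by apply: position; rewrite lx; exact: nesym.
  have [n nE] := position _ _ kx.
  have uh : u = if v == u then v else sigma i v.
    by have [//|vu'] := eqVneq v u; case: vu vu' => ->; rewrite ?eqxx ?sigmaK.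
  exists (Some (a, b, v == u, m, n)) => _; exists (a, b, v == u, m, n) => //.
  by exists y; rewrite -uh -mE -nE.
have finj : {in S &, injective f}.
  move=> j j' jS j'S E; have [[[[[a b] h] m] n] fj cj] := fP j jS.
  have [D'] := fP j' j'S; rewrite -E fj => -[<-] cj'.
  move: cj cj' => [y [[ab my] nst [uE cu] xE kE]] [y' [[_ my'] nst' [uE' cu'] xE' kE']].
  (* The parity of the length is read from the colour of the edge, as [a] and [b] differ. *)
  have ot : odd (t j) = odd (t j').
    move: cu; rewrite cu' => -[]; case: (odd (t j)); case: (odd (t j')) => //.
    by move=> h1; case: ab; rewrite h1.
  have [tt' yy'] := alternate_start ok my my' nst nst' ot (etrans (esym uE) uE').
  have xx' : x j = x j' by rewrite xE xE' yy'.
  by apply: Sinj => //; rewrite kE kE' xx'.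
rewrite -(card_in_imset finj); apply: leq_trans (_ : #|[set Some D | D : data]%SET| <= _)%N.
  apply: subset_leq_card; apply/fintype.subsetP => o /imsetP[j jS ->].
  by have [D -> _] := fP j jS; apply/imsetP; exists D.
apply: leq_trans (leq_imset_card _ _) _.
by rewrite !card_prod card_bool !card_ord.
Qed.

End degree.

End vizing.

(** * Borel colourings and simultaneous chains *)

Section measurable_colorings.
Context d (V : measurableType d) (phi : V -> baire).
Hypotheses (phiI : injective phi) (mphi : measurable_fun setT phi).
Variables (sigma : nat -> V -> V) (q : nat).
Hypotheses (sigmaK : forall i, involutive (sigma i))
  (msigma : forall i, measurable_fun setT (sigma i)).

Definition measurable_coloring (c : coloring V q) :=
  forall i o, measurable [set x | c i x = o].

Lemma measurable_eqfun d' (T : measurableType d') (f g : T -> V) :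
  measurable_fun setT f -> measurable_fun setT g -> measurable [set x | f x = g x].
Proof.
move=> mf mg; rewrite (_ : [set _ | _] =
    [set x | forall n, exists m, phi (f x) n = m /\ phi (g x) n = m]).
  apply: mset_all => n; apply: mset_ex => m; apply: mset_and.
    apply: (@measurable_comp_pred _ _ _ _ (phi \o f) (fun z => z n = m)).
      exact: measurableT_comp.
    exact: measurable_cylinder.
  apply: (@measurable_comp_pred _ _ _ _ (phi \o g) (fun z => z n = m)).
    exact: measurableT_comp.
  exact: measurable_cylinder.
apply/seteqP; split=> x /=; first by move=> -> n; exists (phi (g x) n).
by move=> h; apply: phiI; apply/funext => n; have [m [-> ->]] := h n.
Qed.

Lemma measurable_act w : measurable_fun setT (act sigma w).
Proof.
elim/last_ind: w => [|w i IH]; first exact: measurable_id.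
rewrite (_ : act _ _ = sigma i \o act sigma w); first exact: measurableT_comp.
by apply/funext => x; rewrite /act foldl_rcons.
Qed.

Section coloring.
Variable c : coloring V q.
Hypothesis mc : measurable_coloring c.
Context d' (T : measurableType d') (f : T -> V) (mf : measurable_fun setT f).

Lemma measurable_color i o : measurable [set x | c i (f x) = o].
Proof. exact: (@measurable_comp_pred _ _ _ _ f (fun x => c i x = o)). Qed.

Lemma measurable_missing a : measurable [set x | missing c a (f x)].
Proof. by apply: mset_all => i; apply: mset_not; exact: measurable_color. Qed.

Lemma measurable_dart i : measurable [set x | sigma i (f x) <> f x].
Proof. by apply: mset_not; apply: measurable_eqfun => //; exact: measurableT_comp. Qed.

Lemma measurable_uncolored i : measurable [set x | uncolored sigma c i (f x)].
Proof. by apply: mset_and; [exact: measurable_dart|exact: measurable_color]. Qed.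

End coloring.

Lemma measurable_nbr c e : measurable_coloring c -> proper sigma c ->
  measurable_fun setT (nbr sigma c e).
Proof.
move=> mc okc _ B mB; rewrite setTI (_ : _ @^-1` _ = [set x |
  (exists i, c i x = Some e /\ B (sigma i x)) \/ (missing c e x /\ B x)]).
  apply: mset_or.
    apply: mset_ex => i; apply: mset_and; first exact: mc.
    exact: (@measurable_comp_pred _ _ _ _ (sigma i) B).
  apply: mset_and; last exact: mB.
  exact: (measurable_missing mc (@measurable_id _ V setT) e).
apply/seteqP; split=> x /=.
  have [ex|nex] := pselect (missing c e x); first by rewrite nbr_missing//; right.
  have [i ci] : exists i, c i x = Some e.
    by apply: contrapT => h; apply: nex => i ci; apply: h; exists i.
  by rewrite (nbrP okc ci) => Bi; left; exists i.
by move=> [[i [ci Bi]]|[ex Bx]]; [rewrite (nbrP okc ci)|rewrite nbr_missing].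
Qed.

Lemma measurable_alternate c a b t : measurable_coloring c -> proper sigma c ->
  measurable_fun setT (fun y => alternate sigma c a b y t).
Proof.
move=> mc okc; elim: t => [|t IH]; first exact: measurable_id.
by apply: (measurableT_comp _ IH); exact: measurable_nbr.
Qed.

Lemma measurable_path_edge c t i d' (T : measurableType d') (f g : T -> V) :
  measurable_coloring c -> proper sigma c -> measurable_fun setT f ->
  measurable_fun setT g -> measurable [set x | path_edge sigma c t (f x) i (g x)].
Proof.
move=> mc okc mf mg.
have ms k : measurable_fun setT (fun x => sigma k (f x)) by exact: measurableT_comp.
have ma a b k s : measurable_fun setT (fun x => alternate sigma c a b (sigma k (f x)) s).
  exact: (measurableT_comp (measurable_alternate a b s mc okc) (ms k)).
rewrite (_ : [set _ | _] = [set x | exists a b k, (a <> b) /\ (sigma k (f x) <> f x /\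
  (missing c b (sigma k (f x)) /\
  ((forall s, (s <= t)%N -> alternate sigma c a b (sigma k (f x)) s.+1 <>
     alternate sigma c a b (sigma k (f x)) s) /\
  (c i (alternate sigma c a b (sigma k (f x)) t) = Some (if odd t then b else a) /\
  (g x = alternate sigma c a b (sigma k (f x)) t \/
   g x = sigma i (alternate sigma c a b (sigma k (f x)) t))))))]).
  apply: mset_ex => a; apply: mset_ex => b; apply: mset_ex => k.
  apply: mset_and; first exact: mset_const.
  apply: mset_and; first exact: measurable_dart.
  apply: mset_and; first exact: measurable_missing.
  apply: mset_and.
    by apply: mset_allN => s _; apply: mset_not; apply: measurable_eqfun; exact: ma.
  apply: mset_and; first by apply: measurable_color.
  apply: mset_or; first by apply: measurable_eqfun.
  by apply: measurable_eqfun => //; exact: measurableT_comp.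
apply/seteqP; split=> x /=.
  move=> [a [b [y [ab [yx [k ky]] by_ nst [u [uE cu vu]]]]]].
  have E : y = sigma k (f x) by rewrite -ky sigmaK.
  by exists a, b, k; rewrite -E -uE.
move=> [a [b [k [ab [yx [by_ [nst [cu vu]]]]]]]].
exists a, b, (sigma k (f x)); split => //; first by split => //; exists k; rewrite sigmaK.
by eexists; split; [reflexivity|exact: cu|exact: vu].
Qed.

(** A word leading from a base vertex to an end of an edge, the index of the edge, and its new
    colour. Lists of instructions form a countable type, so that one of them can be selected in a
    Borel way. *)
Definition instruction := (seq nat * nat * option 'I_q)%type.

Definition execute (c : coloring V q) (s : seq instruction) x : coloring V q :=
  foldr (fun ins c => recolor sigma c ins.1.2 (act sigma ins.1.1 x) ins.2) c s.

Lemma measurable_execute c s i o d' (T : measurableType d') (f g : T -> V) :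
  measurable_coloring c -> measurable_fun setT f -> measurable_fun setT g ->
  measurable [set x | execute c s (f x) i (g x) = o].
Proof.
move=> mc mf mg; elim: s => [|[[w j] v] s IH] /=; first exact: measurable_color.
have mw : measurable_fun setT (fun x => act sigma w (f x)).
  exact: (measurableT_comp (measurable_act w) mf).
rewrite (_ : [set _ | _] = [set x |
   (same_edge sigma j (act sigma w (f x)) i (g x) /\ v = o) \/
   (~ same_edge sigma j (act sigma w (f x)) i (g x) /\ execute c s (f x) i (g x) = o)]).
  have mS : measurable [set x | same_edge sigma j (act sigma w (f x)) i (g x)].
    apply: mset_and; first exact: mset_const.
    apply: mset_or; first exact: measurable_eqfun.
    by apply: measurable_eqfun => //; exact: measurableT_comp.
  apply: mset_or; apply: mset_and => //; first exact: mset_const.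
  exact: mset_not.
apply/seteqP; split=> x /=.
  have [h|h] := pselect (same_edge sigma j (act sigma w (f x)) i (g x)).
    by rewrite recolorP//; left.
  by rewrite recolorN//; right.
by move=> [[h <-]|[h <-]]; [rewrite recolorP|rewrite recolorN].
Qed.

Lemma executeP (c c' : coloring V q) s x i v :
  (forall j y, c' j (sigma j y) = c' j y) ->
  (forall ins, ins \in s -> ins.2 = c' ins.1.2 (act sigma ins.1.1 x)) ->
  execute c s x i v = c' i v \/ (execute c s x i v = c i v /\
    forall ins, ins \in s -> ~ same_edge sigma ins.1.2 (act sigma ins.1.1 x) i v).
Proof.
move=> cs; elim: s => [|[[w j] o] s IH] sc /=; first by right.
have [h|h] := pselect (same_edge sigma j (act sigma w x) i v).
  left; rewrite recolorP//; have /= -> := sc _ (mem_head _ _).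
  by case: h => <- [->|->]; rewrite ?cs.
rewrite recolorN//; have [|->|[-> sN]] := IH.
- by move=> ins si; apply: sc; rewrite inE si orbT.
- by left.
- by right; split => // ins; rewrite inE => /predU1P[->//|/sN].
Qed.

End measurable_colorings.

(** * Chains that start far apart, performed simultaneously *)

Section simultaneous_step.
Context d (V : measurableType d) (phi : V -> baire).
Hypotheses (phiI : injective phi) (mphi : measurable_fun setT phi).
Variables (sigma : nat -> V -> V) (q : nat).
Hypotheses (sigmaK : forall i, involutive (sigma i))
  (msigma : forall i, measurable_fun setT (sigma i)).
Variables (Delta mult : nat) (darts : V -> seq nat).
Hypotheses
  (dartsP : forall x i, i \in darts x <-> sigma i x <> x)
  (size_darts : forall x, (size (darts x) <= Delta)%N)
  (count_darts : forall x y, y <> x ->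
    (count (fun i => sigma i x == y) (darts x) <= mult)%N)
  (qE : (Delta + mult <= q)%N).

Local Notation act := (act sigma).

Lemma act_cat w w' x : act (w ++ w') x = act w' (act w x).
Proof. exact: foldl_cat. Qed.

Lemma act_rev w x : act (rev w) (act w x) = x.
Proof.
elim: w x => // i w IH x.
by rewrite rev_cons -cats1 act_cat -[act (i :: w) x]/(act w (sigma i x)) IH; exact: sigmaK.
Qed.

Lemma finite_ball x R : exists ws : seq (seq nat), forall w, (size w <= R)%N ->
  exists2 w', w' \in ws & act w' x = act w x.
Proof.
elim: R => [|R [ws IH]].
  by exists [:: [::]] => w; rewrite leqn0 size_eq0 => /eqP ->; exists [::]; rewrite ?inE.
exists (ws ++ [seq rcons w i | w <- ws, i <- darts (act w x)]) => w.
case/lastP: w => [|w i]; first by move=> _; have [//|w' ww' ew'] := IH [::];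
  exists w' => //; rewrite mem_cat ww'.
rewrite size_rcons ltnS => /IH[w' ww' ew'].
rewrite -cats1 act_cat -ew'.
have [e|e] := pselect (sigma i (act w' x) = act w' x).
  by exists w'; [rewrite mem_cat ww'|rewrite -[RHS]/(sigma i (act w' x)) e].
exists (rcons w' i); last by rewrite -cats1 act_cat.
by rewrite mem_cat; apply/orP; right; apply/allpairsPdep; exists w', i; split => //; exact/dartsP.
Qed.

Variables (c : coloring V q) (t i0 : nat).
Hypotheses (mc : measurable_coloring c) (okc : proper sigma c).

(* The conclusion of [vizing_step], read on the orbit of [x] only: there the
   quantifiers are countable. *)
Definition local_step (c' : coloring V q) x :=
  (forall i w, c' i (sigma i (act w x)) = c' i (act w x)) /\
  ((forall i w a, c' i (act w x) = Some a -> sigma i (act w x) <> act w x) /\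
  ((forall i j w a, c' i (act w x) = Some a -> c' j (act w x) = Some a -> i = j) /\
  ((forall i w, c' i (act w x) <> c i (act w x) ->
     exists w', (size w' <= t.+2)%N /\ act w x = act w' x) /\
  (forall i w, uncolored sigma c' i (act w x) ->
     (uncolored sigma c i (act w x) /\ ~ same_edge sigma i0 x i (act w x)) \/
     path_edge sigma c t x i (act w x))))).

Let good s x := local_step (execute sigma c s x) x.

(** The colouring of [vizing_step] differs from [c] only in a ball around [x]. This ball is finite,
    so finitely many instructions produce the colouring. *)
Let exists_good x : uncolored sigma c i0 x -> exists s, good s x.
Proof.
move=> u0; have [c' [ok' cc' uc']] := vizing_step sigmaK dartsP size_darts
  count_darts qE t okc u0.
have [ws wsP] := finite_ball x t.+2.
pose s : seq (instruction q) := [seq (w, i, c' i (act w x)) | w <- ws, i <- darts (act w x)].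
have [c's c'd c'p] := ok'.
have E : execute sigma c s x = c'.
  apply/funext => i; apply/funext => v.
  have [|->|[-> sN]] := @executeP _ V sigma q c c' s x i v c's.
  - by move=> ins /allpairsPdep[w [j [_ _ ->]]].
  - by [].
  apply: contrapT => ne; have [w wt vw] := cc' i v (nesym ne).
  have [w' ww' ew'] := wsP w wt.
  have iv : sigma i v <> v.
    have [_ cd _] := okc; move: ne; case E : (c i v) => [a|]; first by move=> _; exact: cd E.
    by case E' : (c' i v) => [a|//] _; exact: c'd E'.
  apply: (sN (w', i, c' i (act w' x))); last by split=> //=; left; rewrite ew'.
  by apply/allpairsPdep; exists w', i; split => //; apply/dartsP; rewrite ew' -vw.
exists s; rewrite /good E; split; first by move=> i w.
split; first by move=> i w a; exact: c'd.
split; first by move=> i j w a; exact: c'p.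
split; first by move=> i w /cc'[w' wt ->]; exists w'.
by move=> i w; exact: uc'.
Qed.

Let measurable_good s : measurable [set x | good s x].
Proof.
have mx i o w : measurable [set x | execute sigma c s x i (act w x) = o].
  by apply: (measurable_execute phiI mphi msigma s i o mc) => //; exact: measurable_act.
have mxs i o w : measurable [set x | execute sigma c s x i (sigma i (act w x)) = o].
  apply: (measurable_execute phiI mphi msigma s i o mc) => //.
  by apply: (measurableT_comp (msigma i)); exact: measurable_act.
have md i w : measurable [set x | sigma i (act w x) <> act w x].
  by apply: (measurable_dart phiI mphi msigma); exact: measurable_act.
have mee (f g : V -> option 'I_q) : (forall o, measurable [set x | f x = o]) ->
    (forall o, measurable [set x | g x = o]) -> measurable [set x | f x = g x].
  move=> mf mg; rewrite (_ : [set _ | _] = [set x | exists o, f x = o /\ g x = o]).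
    by apply: mset_ex => o; exact: mset_and.
  by apply/seteqP; split=> x /=; [move=> E; exists (g x)|move=> [z [-> ->]]].
have mu (c' : V -> coloring V q) i w :
    (forall o, measurable [set x | c' x i (act w x) = o]) ->
    measurable [set x | uncolored sigma (c' x) i (act w x)].
  by move=> mc'; apply: mset_and; [exact: md|exact: mc'].
have mcw i w o : measurable [set x | c i (act w x) = o].
  by apply: measurable_color => //; exact: measurable_act.
apply: mset_and.
  by apply: mset_all => i; apply: mset_all => w; apply: mee.
apply: mset_and.
  by apply: mset_all => i; apply: mset_all => w; apply: mset_all => a; apply: mset_imp.
apply: mset_and.
  apply: mset_all => i; apply: mset_all => j; apply: mset_all => w; apply: mset_all => a.
  by apply: mset_imp => //; apply: mset_imp => //; exact: mset_const.
apply: mset_and; apply: mset_all => i; apply: mset_all => w.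
  apply: mset_imp; first by apply: mset_not; exact: mee.
  apply: mset_exN => w' _.
  by apply: (measurable_eqfun phiI mphi); exact: measurable_act.
apply: mset_imp; first exact: mu.
apply: mset_or.
  apply: mset_and; first exact: (mu (fun=> c)).
  apply: mset_not; apply: mset_and; first exact: mset_const.
  apply: mset_or; apply: (measurable_eqfun phiI mphi) => //; exact: measurable_act.
by apply: (measurable_path_edge phiI mphi sigmaK msigma) => //; exact: measurable_act.
Qed.

(** A Borel selection: the least code among countably many lists. *)
Let first_good s x := good s x /\ forall s', (pickle s' < pickle s)%N -> ~ good s' x.

Let exists_first_good x : uncolored sigma c i0 x -> exists s, first_good s x.
Proof.
move=> /exists_good[s sx].
have h : exists n, `[< exists2 s, pickle s = n & good s x >].
  by exists (pickle s); apply/asboolP; exists s.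
have := ex_minnP h => -[n /asboolP[s' <- gs'] nmin].
exists s'; split => // s'' ss gs''; have := nmin (pickle s'').
rewrite leqNgt ss => /(_ _)/negP; apply => //; apply/asboolP.
by exists s''.
Qed.

Variable X : set V.
(** A vertex within [t + 3] of [x] has its neighbours within [t + 4], where the new colouring must
    still be the one made at [x]. So the balls of radii [t + 3] and [t + 4] around distinct points
    of [X] must not meet. *)
Hypotheses (mX : measurable X) (Xu : forall x, X x -> uncolored sigma c i0 x)
  (Xsep : forall x w, X x -> X (act w x) -> (size w <= t.+3 + t.+4)%N -> act w x = x).

Let near r x v := exists2 w, (size w <= r)%N & v = act w x.

Let cx x := execute sigma c (xget [::] [set s | first_good s x]) x.

Let cxP x : X x -> local_step (cx x) x.
Proof.
move=> /Xu/exists_first_good h.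
by have [] := @xgetPex _ [::] [set s | first_good s x] h.
Qed.

Let root v := xget v [set x | X x /\ near t.+3 x v].

Let glued : coloring V q := fun i v =>
  if `[< X (root v) /\ near t.+3 (root v) v >] then cx (root v) i v else c i v.

Let near_uniq r s x y v : X x -> X y -> near r x v -> near s y v ->
  (r <= t.+3)%N -> (s <= t.+4)%N -> x = y.
Proof.
move=> Xx Xy [w wr vw] [w' ws vw'] rt st.
have E : y = act (w ++ rev w') x by rewrite act_cat -vw vw' act_rev.
rewrite E; apply/esym/Xsep => //; first by rewrite -E.
by rewrite size_cat size_rev leq_add// ?(leq_trans wr)// (leq_trans ws).
Qed.

(** If no point of [X] is within [t + 3] of [v], then [glued] is [c] at [v], and so is [cx x], which
    changes [c] only within distance [t + 2] of [x]. *)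
Let glued_near x v i : X x -> near t.+4 x v -> glued i v = cx x i v.
Proof.
move=> Xx xv; rewrite /glued; case: asboolP => [[Xr rv]|nr].
  by rewrite (near_uniq Xr Xx rv xv).
apply: contrapT => ne; have [_ [_ [_ [cc _]]]] := cxP Xx.
have [w wt vw] := xv; rewrite vw in ne.
have [w' [wt' ww']] := cc i w (nesym ne).
apply: nr; rewrite /root; apply: (@xgetPex _ v [set x | X x /\ near t.+3 x v]).
by exists x; split => //; exists w'; [exact: leqW|rewrite vw].
Qed.

Let glued_far v i : (forall x, X x -> ~ near t.+3 x v) -> glued i v = c i v.
Proof. by move=> h; rewrite /glued; case: asboolP => // -[/h]. Qed.

Let near_sigma r x v i : near r x v -> near r.+1 x (sigma i v).
Proof.
by move=> [w wr ->]; exists (rcons w i); rewrite ?size_rcons// -cats1 act_cat.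
Qed.

Let near_leq r s x v : (r <= s)%N -> near r x v -> near s x v.
Proof. by move=> rs [w wr ->]; exists w => //; exact: leq_trans rs. Qed.

Let measurable_glued : measurable_coloring glued.
Proof.
move=> i o; rewrite (_ : [set _ | _] = [set v |
  (exists w, (size w <= t.+3)%N /\ (X (act w v) /\ exists s,
     (first_good s (act w v) /\ execute sigma c s (act w v) i v = o))) \/
  (~ (exists w, (size w <= t.+3)%N /\ X (act w v)) /\ c i v = o)]).
  have mXw w : measurable [set v | X (act w v)].
    by apply: (@measurable_comp_pred _ _ _ _ (act w) X) => //; exact: measurable_act.
  apply: mset_or; last first.
    by apply: mset_and => //; apply: mset_not; apply: mset_exN.
  apply: mset_exN => w _; apply: mset_and => //; apply: mset_ex => s.
  apply: mset_and; last first.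
    apply: (measurable_execute phiI mphi msigma s i o mc) => //; exact: measurable_act.
  apply: (@measurable_comp_pred _ _ _ _ (act w) (first_good s)); first exact: measurable_act.
  by apply: mset_and => //; apply: mset_allN => s' _; exact: mset_not.
have word r x v : near r x v -> exists2 w, (size w <= r)%N & x = act w v.
  by move=> [w wr ->]; exists (rev w); rewrite ?size_rev// act_rev.
have cxE x s : X x -> first_good s x -> cx x = execute sigma c s x.
  move=> Xx [gs smin]; rewrite /cx; congr execute.
  have [gs' smin'] := @xgetPex _ [::] [set s | first_good s x] (ex_intro _ s (conj gs smin)).
  set s' := xget _ _ in gs' smin' *.
  apply: (pcan_inj pickleK); have [ss'|ss'|//] := ltngtP (pickle s') (pickle s).
    by case: (smin s').
  by case: (smin' s).
apply/seteqP; split=> v /=.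
  have [[x [Xx xv]]|nex] := pselect (exists x, X x /\ near t.+3 x v).
    rewrite (@glued_near x)//; last exact: near_leq xv.
    have [s fs] := exists_first_good (Xu Xx); rewrite (cxE x s)// => E; left.
    have [w wt xw] := word _ _ _ xv; exists w; split => //; rewrite -xw; split => //.
    by exists s.
  rewrite glued_far => [E|x Xx xv]; last by apply: nex; exists x.
  right; split => // -[w [wt Xw]]; apply: nex; exists (act w v); split => //.
  by exists (rev w); rewrite ?size_rev// act_rev.
move=> [[w [wt [Xw [s [fs <-]]]]]|[nex <-]].
  rewrite -(cxE _ s)//; apply: glued_near => //; exists (rev w); rewrite ?act_rev//.
  by rewrite size_rev leqW.
apply: glued_far => x Xx /word[w wt xw]; apply: nex; exists w; split => //.
by rewrite -xw.
Qed.

Let farP v : (exists2 x, X x & near t.+3 x v) \/ forall x, X x -> ~ near t.+3 x v.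
Proof.
have [[x xv]|nex] := pselect (exists x, X x /\ near t.+3 x v).
  by left; exists x; case: xv.
by right=> x Xx xv; apply: nex; exists x.
Qed.

(** Each condition of properness concerns a vertex and its neighbours. Near a point of [X] all of
    them are coloured by the chain of that point; a condition between far vertices only is inherited
    from [c]. *)
Lemma simultaneous_step : exists c' : coloring V q, [/\ measurable_coloring c', proper sigma c' &
  forall i v, uncolored sigma c' i v ->
    (uncolored sigma c i v /\ forall x, X x -> ~ same_edge sigma i0 x i v) \/
    exists2 x, X x & path_edge sigma c t x i v].
Proof.
exists glued; have [cs cd cp] := okc; split; first exact: measurable_glued.
  split.
  - have sym i v : (exists2 x, X x & near t.+3 x v) -> glued i (sigma i v) = glued i v.
      move=> [x Xx xv]; rewrite (glued_near i Xx (near_sigma i xv)).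
      rewrite (glued_near i Xx (near_leq (leqnSn _) xv)).
      by have [w _ ->] := xv; have [h _] := cxP Xx; exact: h.
    move=> i v; have [/sym//|fv] := farP v.
    have [/(sym i)|fsv] := farP (sigma i v); first by rewrite sigmaK.
    by rewrite !glued_far.
  - move=> i v a; have [[x Xx xv]|fv] := farP v; last by rewrite glued_far//; exact: cd.
    rewrite (glued_near i Xx (near_leq (leqnSn _) xv)); have [w _ ->] := xv.
    by have [_ [h _]] := cxP Xx; exact: h.
  - move=> i j v a; have [[x Xx xv]|fv] := farP v; last by rewrite !glued_far//; exact: cp.
    rewrite !(glued_near _ Xx (near_leq (leqnSn _) xv)); have [w _ ->] := xv.
    by have [_ [_ [h _]]] := cxP Xx; exact: h.
move=> i v.
have same_near x : X x -> same_edge sigma i0 x i v -> near t.+3 x v.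
  by move=> Xx [_ [->|->]]; [exists [::]|exists [:: i0]].
have [[x Xx xv]|fv] := farP v; last first.
  rewrite /uncolored glued_far// => uv; left; split => // x Xx /(same_near x Xx).
  exact: fv.
rewrite /uncolored (glued_near i Xx (near_leq (leqnSn _) xv)) => uv.
have [_ [_ [_ [_ h]]]] := cxP Xx.
have [w _ vw] := xv; rewrite vw in uv; have := h i w uv; rewrite -vw => -[[uc ns]|pe].
  left; split => // y Xy sy; apply: ns.
  by rewrite (near_uniq Xx Xy xv (same_near y Xy sy)).
by right; exists x.
Qed.

End simultaneous_step.

(** * Averaging over the cuts *)

Section arith.
Local Open Scope ring_scope.

(** Here [l] counts the lengths, [n] the classes, [s] sums the repaired parts over the classes and
    [p] sums the new parts. The hypotheses give [s >= 3 * delta / 4], while the excess of [u] over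
    [delta] and the term [p] contribute at most [l * delta / 4] each, so the gain [l * s] is too
    large. *)
Lemma averaging_contradiction (R : realFieldType) (l n delta u s p k : R) :
  0 < l -> 0 < n -> 0 < delta -> delta <= u -> u <= delta + delta / (4 * n) -> u <= s + delta / 4 ->
  delta * (l * n) <= u * (l * n) - l * s + p -> p <= k -> 4 * k <= delta * l -> False.
Proof.
move=> l0 n0 d0 du ud us bound pk kl.
have hs : l * (u - delta / 4) <= l * s by rewrite ler_pM2l// lerBlDr.
have hu : u * (l * n) <= delta * (l * n) + l * (delta / 4).
  apply: le_trans (_ : (delta + delta / (4 * n)) * (l * n) <= _).
    by rewrite ler_pM2r// mulr_gt0.
  rewrite mulrDl lerD2l le_eqVlt; apply/orP; left; apply/eqP; field.
  exact: lt0r_neq0.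
have hd : l * delta <= l * u by rewrite ler_pM2l.
have ld : 0 < l * delta by rewrite mulr_gt0.
lra.
Qed.

End arith.

Section averaging.
Local Open Scope ring_scope.
Local Open Scope ereal_scope.
Context d (T : measurableType d) (R : realType) (kappa : {measure set T -> \bar R}).

(** The sum is the integral over [E] of the number of sets that contain a given point. *)
Lemma sum_measure_le (I : finType) (P : I -> set T) (E : set T) (K : nat) :
  measurable E -> (forall i, measurable (P i)) -> (forall i, P i `<=` E) ->
  (forall x, (#|[set i | x \in P i]%SET| <= K)%N) ->
  \sum_(i : I) kappa (P i) <= K%:R%:E * kappa E.
Proof.
move=> mE mP PE PK.
have -> : \sum_(i : I) kappa (P i) = \int[kappa]_(x in E) \sum_(i : I) (\1_(P i) x)%:E.
  rewrite ge0_integral_sum//; last first.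
  - by move=> i; apply/measurable_EFinP; exact: measurable_indic.
  apply: eq_bigr => i _; rewrite integral_indic// (_ : P i `&` E = P i)//.
  by apply/setIidPl; exact: PE.
rewrite -(integral_cst kappa mE); apply: ge0_le_integral => //.
- by move=> x _; apply: sume_ge0 => i _; rewrite lee_fin.
- apply: emeasurable_sum => i; apply/measurable_EFinP; exact: measurable_indic.
- move=> x _ /=; rewrite sumEFin lee_fin.
  rewrite (_ : (\sum_i _)%R = (#|[set i | x \in P i]%SET|)%:R :> R) ?ler_nat//.
  rewrite -sum1_card natr_sum [RHS]big_mkcond /=; apply: eq_bigr => i _.
  by rewrite indicE inE; case: (x \in P i).
Qed.

(** If the infimum [delta] of the measures were positive, a nearly optimal [U] could hardly be
    improved by any [U' t n]. But summed over [n], for each [t], the removed parts [U] meets [D n]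
    have measure about that of [U], while the added parts have total measure at most [K * kappa E]
    over all [t] and [n]. *)
Lemma averaging (E : set T) (K : nat) (Us : set (set T)) :
  measurable E -> kappa E < +oo -> Us !=set0 ->
  (forall U, Us U -> measurable U /\ U `<=` E) ->
  (forall L, exists D : nat -> set T, [/\ forall n, measurable (D n),
    E `<=` \bigcup_n D n &
    forall U, Us U -> exists U' : nat -> nat -> set T,
      (forall t n, Us (U' t n)) /\ forall N x,
      (#|[set tn : 'I_L * 'I_N | x \in U' tn.1 tn.2 `\` (U `\` D tn.2)]%SET| <= K)%N]) ->
  forall eps : R, (0 < eps)%R -> exists2 U, Us U & kappa U <= eps%:E.
Proof.
move=> mE fE [U0 UsU0] UsE step eps eps0; apply: contrapT => small.
have fin A : measurable A -> A `<=` E -> kappa A \is a fin_num.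
  move=> mA AE; rewrite ge0_fin_numE//; apply: le_lt_trans fE.
  by apply: le_measure; rewrite ?inE.
pose u A := fine (kappa A).
have uK A : measurable A -> A `<=` E -> kappa A = (u A)%:E.
  by move=> mA AE; rewrite fineK//; exact: fin.
have u0 A : (0 <= u A)%R by exact: fine_ge0.
pose S := [set u U | U in Us]%classic.
have Seps x : S x -> (eps <= x)%R.
  move=> [U UsU <-]; rewrite leNgt; apply/negP => Ueps; apply: small; exists U => //.
  by have [mU UE] := UsE _ UsU; rewrite uK// lee_fin ltW.
have infS : has_inf S by split; [exists (u U0), U0|exists eps => x /Seps].
pose delta := inf S.
have d0 : (0 < delta)%R.
  by apply: lt_le_trans eps0 _; apply: lb_le_inf => [|x /Seps//]; case: infS.
have dle U : Us U -> (delta <= u U)%R.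
  by move=> UsU; apply: ge_inf; [case: infS|exists U].
(* With this many lengths the new parts cost at most [delta / 4] for each length on average. *)
have [L L0 LK] : exists2 L, (0 < L)%N & (4 * (K%:R * u E) <= delta * L%:R)%R.
  exists (Num.bound (4 * (K%:R * u E) / delta)).+1 => //.
  rewrite [leRHS]mulrC -ler_pdivrMr//; apply: ltW.
  apply: (@lt_le_trans _ _ (Num.bound (4 * (K%:R * u E) / delta))%:R); last first.
    by rewrite ler_nat.
  by apply: archi_boundP; rewrite divr_ge0 ?(ltW d0)// !mulr_ge0.
have [D [mD ED UD]] := step L.
pose F n := E `\` \bigcup_(k < n) D k.
have mF n : measurable (F n).
  apply: measurableD => //; apply: bigcup_measurable => k _; exact: mD.
have FE n : F n `<=` E by move=> x [].
have [N FN] : exists N, (u (F N.+1) <= delta / 4)%R.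
  have F0 : \bigcap_n F n = set0.
    apply/seteqP; split=> // x Fx; have [Ex _] := Fx 0%N I; have [n _ Dn] := ED x Ex.
    by have [_] := Fx n.+1 I; apply; exists n => /=.
  have : kappa (F n) @[n --> \oo] --> kappa set0.
    rewrite -F0; apply: nonincreasing_cvg_mu => //.
    - by apply: le_lt_trans fE; apply: le_measure; rewrite ?inE.
    - by rewrite F0; exact: measurable0.
    - move=> n m nm; apply/subsetPset => x [Ex nD]; split => // -[k /= kn Dk].
      by apply: nD; exists k => //=; exact: leq_trans kn nm.
  rewrite measure0 => /fine_cvgP[_ /cvgrPdist_le] /(_ (delta / 4)%R).
  case; first by rewrite divr_gt0.
  move=> N _ /(_ N.+1 (leqnSn N)) /=; rewrite sub0r normrN => h; exists N.
  exact: le_trans (ler_norm _) h.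
pose N' := N.+1; have N0 : (0 < N'%:R :> R)%R by rewrite ltr0n.
(* The error is divided by the number of classes, since it is incurred once for each class; [N] is
   available here because the [D n] do not depend on [U]. *)
have [_ [U UsU <-] Udelta] := inf_adherent (divr_gt0 d0 (mulr_gt0 (ltr0n R 4) N0)) infS.
have [mU UE] := UsE U UsU.
have [U' [UsU' PK]] := UD U UsU.
pose P (tn : 'I_L * 'I_N') := U' tn.1 tn.2 `\` (U `\` D tn.2).
have mP tn : measurable (P tn).
  by apply: measurableD; [exact: (UsE _ (UsU' _ _)).1|exact: measurableD].
have PE tn : P tn `<=` E.
  by apply: subset_trans (UsE _ (UsU' tn.1 tn.2)).2; exact: subDsetl.
have sumP : (\sum_tn u (P tn) <= K%:R * u E)%R.
  have := sum_measure_le mE mP PE (PK N').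
  rewrite (eq_bigr (fun tn => (u (P tn))%:E)); last by move=> tn _; exact: uK.
  by rewrite sumEFin uK// -EFinM lee_fin.
have UDE n : U `&` D n `<=` E by move=> x [/UE].
have mUD n : measurable (U `&` D n) by exact: measurableI.
have sumD : (u U <= \sum_(n < N') u (U `&` D n) + delta / 4)%R.
  apply: le_trans (_ : \sum_(n < N') u (U `&` D n) + u (F N') <= _)%R; last by rewrite lerD2l.
  have cov : U `<=` (\big[setU/set0]_(n < N') (U `&` D n)) `|` F N'.
    move=> x Ux; have [h|h] := pselect ((\bigcup_(k < N') D k) x).
      by left; rewrite -(bigcup_mkord N' (fun n => U `&` D n)); have [k kN Dk] := h; exists k.
    by right; split => //; exact: UE.
  have mB : measurable (\big[setU/set0]_(n < N') (U `&` D n)).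
    by apply: bigsetU_measurable => n _.
  rewrite -lee_fin EFinD -sumEFin -uK// (eq_bigr (fun n : 'I_N' => kappa (U `&` D n))); last first.
    by move=> n _; rewrite uK.
  rewrite -uK//; apply: le_trans (_ : kappa (\big[setU/set0]_(n < N') (U `&` D n) `|` F N') <= _).
    by apply: le_measure; rewrite ?inE//; exact: measurableU.
  apply: le_trans (measureU2 _ mB (mF _)) _; rewrite leeD2r//.
  by apply: (Boole_inequality kappa (A := fun n => U `&` D n)).
have each (tn : 'I_L * 'I_N') : (delta <= u U - u (U `&` D tn.2) + u (P tn))%R.
  have UsT := UsU' tn.1 tn.2; have [mT TE] := UsE _ UsT.
  apply: le_trans (dle _ UsT) _.
  have UDE' : U `\` D tn.2 `<=` E by move=> x [/UE].
  have mUD' : measurable (U `\` D tn.2) by exact: measurableD.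
  have -> : (u U - u (U `&` D tn.2) = u (U `\` D tn.2))%R.
    apply/eqP; rewrite subr_eq; apply/eqP.
    have : kappa U = kappa (U `\` D tn.2) + kappa (U `&` D tn.2) by exact: measureDI.
    rewrite (uK _ mU UE) (uK _ mUD' UDE') (uK _ (mUD _) (UDE _)) -EFinD.
    by move=> [->].
  rewrite -lee_fin EFinD -(uK _ mT TE) -(uK _ mUD' UDE') -(uK _ (mP _) (PE _)).
  apply: le_trans (_ : kappa ((U `\` D tn.2) `|` P tn) <= _); last exact: measureU2.
  apply: le_measure; rewrite ?inE//; first exact: measurableU.
  by move=> x Tx; have [|h] := pselect ((U `\` D tn.2) x); [left|right].
have : (\sum_(tn : 'I_L * 'I_N') delta <=
    \sum_(tn : 'I_L * 'I_N') (u U - u (U `&` D tn.2) + u (P tn)))%R.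
  by apply: ler_sum => tn _; exact: each.
rewrite big_split /= sumrB !sumr_const card_prod !card_ord.
have -> : (\sum_(tn : 'I_L * 'I_N') u (U `&` D tn.2) =
    L%:R * \sum_(n < N') u (U `&` D n))%R.
  rewrite -(pair_bigA _ (fun (t : 'I_L) (n : 'I_N') => u (U `&` D n))) /=.
  by rewrite sumr_const card_ord mulr_natl.
rewrite -[(delta *+ _)%R]mulr_natr -[(u U *+ _)%R]mulr_natr natrM => bound.
apply: (averaging_contradiction _ N0 d0 (dle _ UsU) (ltW Udelta) sumD bound sumP LK).
by rewrite ltr0n.
Qed.

End averaging.

Section slices.
Local Open Scope ring_scope.

(** The measure on darts in which [(i, x)] weighs as much as [x]. The two darts of an edge may have
    unrelated weights, so cuts are counted dart by dart. *)
Lemma slice_measure d (V : measurableType d) (R : realType) (mu : {measure set V -> \bar R}) :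
  exists kappa : {measure set (nat * V) -> \bar R},
    forall A, kappa A = (\sum_(0 <= i <oo) mu [set x | A (i, x)])%E.
Proof.
have m (i : nat) : {m : {measure set (nat * V) -> \bar R} |
    forall A, m A = mu [set x | A (i, x)]}.
  unshelve eexists.
    unshelve refine (pushforward mu (pair i) : {measure set _ -> \bar R}).
    exact: pair1_measurable.
  by [].
exists (mseries (fun i => sval (m i)) 0) => A.
by rewrite /mseries; apply: eq_eseriesr => i _; rewrite (svalP (m i)).
Qed.

End slices.

(** * The average applied to the sets of uncoloured darts *)

Section approximate_coloring.
Local Open Scope ereal_scope.
Context d (V : measurableType d) (R : realType) (mu : probability V R) (phi : V -> baire).
Hypotheses (phiI : injective phi) (mphi : measurable_fun setT phi).
Variables (sigma : nat -> V -> V) (q : nat).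
Hypotheses (sigmaK : forall i, involutive (sigma i))
  (msigma : forall i, measurable_fun setT (sigma i)).
Variables (Delta mult : nat) (darts : V -> seq nat).
Hypotheses (dartsP : forall x i, i \in darts x <-> sigma i x <> x)
  (size_darts : forall x, (size (darts x) <= Delta)%N)
  (count_darts : forall x y, y <> x ->
    (count (fun i => sigma i x == y) (darts x) <= mult)%N)
  (qE : (Delta + mult <= q)%N).

Local Notation act := (act sigma).

(** A class consists of vertices with a given prefix that no other vertex within distance [r]
    shares. Balls are finite, so every vertex has such a prefix; the classes are then made
    disjoint. *)
Lemma separated_cover r : exists W : nat -> set V, [/\ forall n, measurable (W n),
  trivIset setT W, forall x, exists n, W n x &
  forall n x w, W n x -> W n (act w x) -> (size w <= r)%N -> act w x = x].
Proof.
pose in_cyl s x := mkseq (phi x) (size s) = s.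
pose W0 n := [set x | exists s, unpickle n = Some s /\ (in_cyl s x /\
  forall w, (size w <= r)%N -> (act w x <> x -> ~ in_cyl s (act w x)))].
have mW0 n : measurable (W0 n).
  apply: mset_exN => s _.
  have mc (f : V -> V) : measurable_fun setT f -> measurable [set x | in_cyl s (f x)].
    move=> mf; apply: (@measurable_comp_pred _ _ _ _ f (in_cyl s)) => //.
    exact: measurable_prefix.
  apply: mset_and; first exact: (mc id).
  apply: mset_allN => w _; apply: mset_imp; apply: mset_not.
    by apply: (measurable_eqfun phiI mphi) => //; exact: measurable_act.
  by apply: mc; exact: measurable_act.
exists (seqDU W0); split.
- exact: seqDU_measurable.
- exact: trivIset_seqDU.
- move=> x; have [ws wsP] := finite_ball dartsP x r.
  have [k kI] := prefixes_differ phiI (x :: [seq act w x | w <- ws]).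
  suff : (\bigcup_n W0 n) x by rewrite seqDU_bigcup_eq => -[n _ h]; exists n.
  exists (pickle (mkseq (phi x) k)) => //; exists (mkseq (phi x) k).
  rewrite pickleK /in_cyl size_mkseq; split => //; split => // w wr wx E; apply: wx.
  apply: kI => //; last exact: mem_head.
  by have [w' ww' <-] := wsP w wr; rewrite inE (map_f (act^~ x)) ?orbT.
- move=> n x w Wx Wwx wr; apply: contrapT => wx.
  have [s [ns [sx sw]]] := subset_seqDU Wx.
  have [s' [ns' [swx _]]] := subset_seqDU Wwx.
  by move: ns' swx; rewrite ns => -[<-]; exact: (sw w wr wx).
Qed.

Let E : set (nat * V) := [set p | sigma p.1 p.2 <> p.2].

Let U (c : coloring V q) : set (nat * V) := [set p | uncolored sigma c p.1 p.2].

Let measurable_slices (A : nat -> V -> Prop) : (forall i, measurable [set x | A i x]) ->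
  measurable [set p : nat * V | A p.1 p.2].
Proof.
move=> mA; rewrite (_ : [set _ | _] = [set p : nat * V | exists i, p.1 = i /\ A i p.2]).
  apply: mset_ex => i; apply: mset_and.
    by apply: (@measurable_comp_pred _ _ _ _ (@fst nat V) (fun j => j = i)).
  by apply: (@measurable_comp_pred _ _ _ _ (@snd nat V) (A i)).
by apply/seteqP; split=> -[i x] /= => [h|[j [-> ]]//]; exists i.
Qed.

Let measurable_E : measurable E.
Proof.
apply: (measurable_slices (A := fun i x => sigma i x <> x)) => i.
exact: (measurable_dart phiI mphi msigma (@measurable_id _ V setT)).
Qed.

Let measurable_U c : measurable_coloring c -> measurable (U c).
Proof.
move=> mc; apply: (measurable_slices (A := uncolored sigma c)) => i.
exact: (measurable_uncolored phiI mphi msigma mc (@measurable_id _ V setT)).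
Qed.

Let sum_darts : \sum_(0 <= i <oo) mu [set x | sigma i x <> x] <= Delta%:R%:E.
Proof.
have mE i : measurable [set x | sigma i x <> x].
  exact: (measurable_dart phiI mphi msigma (@measurable_id _ V setT)).
apply: lime_le; first exact: is_cvg_nneseries.
apply: nearW => n; rewrite big_mkord.
rewrite -[leRHS]mule1 -(probability_setT mu).
apply: (@sum_measure_le _ _ _ mu 'I_n (fun i => [set x | sigma i x <> x])) => // x.
apply: leq_trans (size_darts x).
rewrite cardE -(size_map (@nat_of_ord n)); apply: uniq_leq_size.
  by rewrite (map_inj_uniq (@ord_inj n)) enum_uniq.
by move=> _ /mapP[i + ->]; rewrite mem_enum finset.inE => /set_mem /dartsP.
Qed.

Let step L : exists D : nat -> set (nat * V), [/\ forall n, measurable (D n),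
  E `<=` \bigcup_n D n &
  forall A, (exists c, [/\ measurable_coloring c, proper sigma c & A = U c]) ->
  exists U' : nat -> nat -> set (nat * V),
    (forall t n, exists c, [/\ measurable_coloring c, proper sigma c & U' t n = U c]) /\
    forall N x, (#|[set tn : 'I_L * 'I_N |
      x \in U' tn.1 tn.2 `\` (A `\` D tn.2)]%SET| <= q * q * 2 * Delta * Delta)%N].
Proof.
(* This separation serves all the lengths [t < L] at once. *)
have [W [mW tW cW sW]] := separated_cover (L.+3 + L.+4).
(* [n] codes an index [i] and a class [k]: the chains for [n] start at the uncoloured darts of index
   [i] with centre in [W k]. *)
pose D n : set (nat * V) := [set p | exists ik : nat * nat,
  pickle ik = n /\ (p.1 = ik.1 /\ W ik.2 p.2)].
exists D; split.
- move=> n; apply: mset_exN => -[i k] _ /=; apply: mset_and.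
    by apply: (@measurable_comp_pred _ _ _ _ (@fst nat V) (fun j => j = i)).
  by apply: (@measurable_comp_pred _ _ _ _ (@snd nat V) (W k)) => //; exact: mW.
- move=> [i x] _; have [k Wk] := cW x; exists (pickle (i, k)) => //.
  by exists (i, k).
move=> _ [c [mc okc ->]].
have /choice[f fP] : forall tn : nat * nat, exists c' : coloring V q,
    [/\ measurable_coloring c', proper sigma c' &
    (tn.1 < L)%N -> forall p, (U c' `\` (U c `\` D tn.2)) p -> exists ik x,
      [/\ pickle ik = tn.2, W ik.2 x, uncolored sigma c ik.1 x &
        path_edge sigma c tn.1 x p.1 p.2]].
  move=> [t n] /=; have [[[i0 k] En]|nex] := pselect (exists ik : nat * nat, pickle ik = n);
    last first.
    exists c; split => // _ p [Up []]; split => //.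
    by move=> [ik [En _]]; apply: nex; exists ik.
  have [tL|tL] := ltnP t L; last by exists c.
  pose X := [set x | W k x /\ uncolored sigma c i0 x].
  have [|||c' [mc' okc' uc']] := simultaneous_step phiI mphi sigmaK msigma dartsP
    size_darts count_darts qE mc okc (t := t) (X := X) (i0 := i0).
  - apply: mset_and; first exact: (mW k).
    exact: (measurable_uncolored phiI mphi msigma mc (@measurable_id _ V setT)).
  - by move=> x [].
  - move=> x w [Wx _] [Wax _] wt; apply: (sW k) => //.
    by apply: leq_trans wt _; rewrite leq_add// !ltnS ltnW.
  exists c'; split => // _ [i v] [Uv nD].
  have [[uv nX]|[x [Wx ux] pe]] := uc' i v Uv; last by exists (i0, k), x.
  exfalso; apply: nD; split => // -[ik [/esym]]; rewrite -En => /(pcan_inj pickleK) <- /= [ii0 Wv].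
  apply: (nX v); first by split => //; rewrite -ii0.
  by split => //; left.
exists (fun t n => U (f (t, n))); split.
  by move=> t n; have [mc' okc' _] := fP (t, n); exists (f (t, n)).
move=> N p.
set S := [set tn | _]%SET.
have /choice[g gP] : forall tn : 'I_L * 'I_N, exists ix : nat * V, tn \in S ->
    exists k, [/\ pickle (ix.1, k) = tn.2, W k ix.2,
    uncolored sigma c ix.1 ix.2 & path_edge sigma c tn.1 ix.2 p.1 p.2].
  move=> tn; have [tnS|] := boolP (tn \in S); last by exists (0%N, p.2).
  have [_ _ /(_ (ltn_ord _) p)] := fP (nat_of_ord tn.1, nat_of_ord tn.2).
  case; first by move: tnS; rewrite inE => /set_mem.
  by move=> [i k] [x [e Wx ux pe]]; exists (i, x) => _; exists k.
apply: (count_path_edges (sigma := sigma) sigmaK dartsP size_darts (c := c) (i := p.1) (v := p.2)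
  (t := fun tn => nat_of_ord tn.1) (x := fun tn => (g tn).2) (k := fun tn => (g tn).1)) => //.
  by move=> tn /gP[k [_ _ [ux _] pe]].
(* The centre determines its class by disjointness, and the class with the index of the first edge
   determines [n]. *)
move=> [t n] [t' n'] /gP[k [/= e Wx _ _]] /gP[k' [/= e' Wx' _ _]] tt' xx' kk'.
have kk : k = k' by apply: (tW _ _ I I); exists (g (t, n)).2; split => //; rewrite xx'.
congr pair; first exact: ord_inj.
by apply: ord_inj; rewrite -e -e' kk kk'.
Qed.

Lemma approximate_coloring (eps : R) : (0 < eps)%R -> exists c : coloring V q,
  [/\ measurable_coloring c, proper sigma c &
      mu [set x | exists i, uncolored sigma c i x] <= eps%:E].
Proof.
move=> eps0; have [kappa kappaE] := slice_measure mu.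
pose Us A := exists c, [/\ measurable_coloring c, proper sigma c & A = U c].
have [|||L|A [c [mc okc ->]] Aeps] :=
    @averaging _ _ R kappa E (q * q * 2 * Delta * Delta) Us measurable_E _ _ _ _ eps eps0.
- by rewrite kappaE; apply: le_lt_trans sum_darts _; rewrite ltry.
- exists (U (fun _ _ => None)), (fun _ _ => None); split => // i o.
  exact: mset_const.
- by move=> _ [c [mc _ ->]]; split; [exact: measurable_U|move=> p []].
- exact: step.
exists c; split => //; apply: le_trans Aeps; rewrite kappaE.
have mu_i i : measurable [set x | uncolored sigma c i x].
  exact: (measurable_uncolored phiI mphi msigma mc (@measurable_id _ V setT)).
apply: measure_sigma_subadditive => //; first exact: mset_ex.
by move=> x [i ui]; exists i.
Qed.

End approximate_coloring.

(** * Back to Borel multi-graphs *)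

Section assembly.
Local Open Scope ereal_scope.
Variable R : realType.

Lemma counting_finite (T : choiceType) (A : set T) : counting A < +oo :> \bar R ->
  exists n, [/\ counting A = n%:R%:E :> \bar R,
    forall s : seq T, uniq s -> (forall x, x \in s -> A x) -> (size s <= n)%N &
    exists s : seq T, [/\ uniq s, forall x, x \in s -> A x & size s = n]].
Proof.
rewrite /counting; case: asboolP => [fA _|]; last by rewrite ltxx.
exists (size (finmap.enum_fset (fset_set A))); split => //.
- move=> s us sA; apply: uniq_leq_size us _ => x xs.
  by have := in_fset_set fA x; rewrite [RHS](mem_set (sA x xs)).
- exists (finmap.enum_fset (fset_set A)); split => //.
  by move=> x xs; apply: set_mem; rewrite -(in_fset_set fA x); exact: xs.
Qed.

Lemma nat_sup_attained (T : Type) (t0 : T) (f : T -> \bar R) (g : T -> nat) (B : nat) :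
  (forall x, f x = (g x)%:R%:E) -> (forall x, (g x <= B)%N) ->
  exists2 n, (forall x, (g x <= n)%N) & n%:R%:E <= ereal_sup (range f).
Proof.
move=> fg gB; have h : exists n, `[< exists x, g x = n >].
  by exists (g t0); apply/asboolP; exists t0.
have hB n : `[< exists x, g x = n >] -> (n <= B)%N by move=> /asboolP[x <-].
have [n /asboolP[x gx] nmax] := ex_maxnP h hB.
exists n; first by move=> y; apply: nmax; apply/asboolP; exists y.
by rewrite -gx -fg; apply: ereal_sup_ubound; exists x.
Qed.

Lemma set2_eq (T : Type) (x y u v : T) : [set x; y] = [set u; v] ->
  (x = u /\ y = v) \/ (x = v /\ y = u).
Proof.
move=> E; have [xu|xv] : [set u; v] x by rewrite -E; left.
  left; split => //; have [yu|//] : [set u; v] y by rewrite -E; right.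
  have : [set x; y] v by rewrite E; right.
  by rewrite xu yu => -[].
right; split => //; have [//|yv] : [set u; v] y by rewrite -E; right.
have : [set x; y] u by rewrite E; left.
by rewrite xv yv => -[].
Qed.

Section graph.
Context d (V : measurableType d) (m : nat).
Variable G : borel_multigraph [set: V] m.
Hypothesis hG : max_degree R G < +oo.

Lemma finite_degree_multiplicity : exists Delta pi : nat, [/\
  forall x (s : seq (edge V m)), uniq s -> (forall e, e \in s -> edges G e /\ e.1 x) ->
    (size s <= Delta)%N,
  forall u (s : seq (edge V m)), uniq s -> (forall e, e \in s -> edges G e /\ e.1 = u) ->
    (size s <= pi)%N &
  (Delta + pi)%N%:R%:E <= max_degree R G + max_multiplicity R G].
Proof.
have degE : max_degree R G = ereal_sup (range (degree R G)) by [].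
have /choice[g gP] : forall x, exists n, degree R G x = n%:R%:E /\
    forall s : seq (edge V m), uniq s -> (forall e, e \in s -> edges G e /\ e.1 x) ->
      (size s <= n)%N.
  move=> x; have [|n [nE n1 _]] := @counting_finite _ [set e | edges G e /\ e.1 x].
    by apply: le_lt_trans hG; apply: ereal_sup_ubound; exists x.
  by exists n.
have /choice[h hP] : forall u, exists n, [/\ multiplicity R G u = n%:R%:E,
    forall s : seq (edge V m), uniq s -> (forall e, e \in s -> edges G e /\ e.1 = u) ->
      (size s <= n)%N & (n <= m)%N].
  move=> u; have [|n [nE n1 [s [us sA sn]]]] := @counting_finite _ [set e | edges G e /\ e.1 = u].
    rewrite /counting asboolT ?ltry//.
    apply: (@sub_finite_set _ _ ((fun k : 'I_m => (u, k) : edge V m) @` setT)).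
      by move=> [v k] [_ /= <-]; exists k.
    exact: finite_image.
  exists n; split => //; rewrite -sn -[leqRHS]card_ord -(size_map snd).
  have us2 : uniq [seq e.2 | e <- s].
    rewrite map_inj_in_uniq// => -[v k] [w l] /sA[_ /= ->] /sA[_ /= ->] /= ->//.
  by rewrite -(card_uniqP us2); exact: max_card.
have [B hB] : exists B : nat, max_degree R G <= B%:R%:E.
  move: hG; case: (max_degree R G) => [r _|//|_].
    exists (Num.bound r); rewrite lee_fin; have [r0|r0] := leP 0%R r.
      by apply: ltW; exact: archi_boundP.
    by apply: ltW; apply: lt_le_trans r0 _.
  by exists 0%N; exact: leNye.
have gB x : (g x <= B)%N.
  rewrite -(ler_nat R) -lee_fin; have [<- _] := gP x.
  by apply: le_trans hB; apply: ereal_sup_ubound; exists x.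
have [Delta gD hD] := nat_sup_attained point (fun x => (gP x).1) gB.
have hm u : (h u <= m)%N by have [] := hP u.
have hE u : multiplicity R G u = (h u)%:R%:E by have [] := hP u.
have [pi hpi hpi'] := nat_sup_attained (set0 : set V) hE hm.
exists Delta, pi; split.
- by move=> x s us sA; have [_ +] := gP x => /(_ s us sA) /leq_trans; apply.
- by move=> u s us sA; have [_ + _] := hP u => /(_ s us sA) /leq_trans; apply.
- by rewrite natrD EFinD leeD.
Qed.

Variables (Delta pi : nat).
Hypotheses
  (degG : forall x (s : seq (edge V m)), uniq s ->
    (forall e, e \in s -> edges G e /\ e.1 x) -> (size s <= Delta)%N)
  (multG : forall u (s : seq (edge V m)), uniq s ->
    (forall e, e \in s -> edges G e /\ e.1 = u) -> (size s <= pi)%N).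
Variable phi : V -> baire.
Hypotheses (phiI : injective phi) (mphi : measurable_fun setT phi)
  (mrange : measurable (range phi))
  (phiE : forall A, measurable A ->
    exists2 B : set baire, measurable B & A = phi @^-1` B).

(* An edge of [G] is coded by an index [i] and an end [x] with
   [sigma i x <> x]; its label is [lab i]. *)
Lemma edge_system : exists (sigma : nat -> V -> V) (lab : nat -> nat), [/\
  forall i, measurable_fun setT (sigma i) /\ involutive (sigma i),
  forall i x, sigma i x <> x ->
    exists2 k : 'I_m, lab i = k & edges G ([set x; sigma i x], k),
  forall x y (k : 'I_m), x <> y -> edges G ([set x; y], k) ->
    exists2 i, lab i = k & sigma i x = y &
  forall i j x, sigma i x <> x -> sigma i x = sigma j x -> lab i = lab j -> i = j].
Proof.
pose E (k : 'I_m) : set (V * V) := [set p | p.1 <> p.2 /\ edges G ([set p.1; p.2], k)].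
have /choice[S SP] : forall k, exists sigma : nat -> V -> V, [/\
    forall i, measurable_fun setT (sigma i), forall i x, sigma i (sigma i x) = x,
    forall i x, sigma i x <> x -> E k (x, sigma i x),
    forall x y, E k (x, y) -> exists i, sigma i x = y &
    forall i j x, sigma i x <> x -> sigma i x = sigma j x -> i = j].
  move=> k; apply: (matching_decomposition phiI mphi mrange phiE (n := Delta)).
  - exact: borel_edges.
  - by move=> x y [xy Exy]; split; [exact: nesym|rewrite /= setUC].
  - by move=> x [].
  - move=> x s us sE; rewrite -(size_map (fun y => ([set x; y], k) : edge V m)).
    apply: (degG (x := x)).
      rewrite map_inj_in_uniq// => y z /sE[/= xy _] _ /(congr1 fst)/= E1.
      by have [[_ ->]//|[_ yx]] := set2_eq E1; case: xy.
    by move=> _ /mapP[y /sE[_ Gxy] ->]; split => //; left.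
have [code [f [l [codeK flK]]]] := nat_pairing.
(* [i] codes a label [l i] and a rank [f i] among the matchings of that label; when [l i] is not a
   label, [sigma i] is the identity and carries no edge. *)
pose sigma i x := if insub (l i) is Some k then S k (f i) x else x.
have sigmaE i (k : 'I_m) x : l i = k -> sigma i x = S k (f i) x.
  by rewrite /sigma => ->; rewrite valK.
have sigma_neq i x : sigma i x <> x -> exists2 k : 'I_m, l i = k & S k (f i) x <> x.
  by rewrite /sigma; case: insubP => // k _ <- h; exists k.
exists sigma, l; split.
- move=> i; rewrite /sigma; case: insubP => [k _ _|_]; last first.
    by split; [exact: measurable_id|].
  by have [mS SK _ _ _] := SP k; split; [exact: mS|exact: SK].
- move=> i x /[dup] ix /sigma_neq[k ik Sx]; exists k => //.
  by rewrite (sigmaE i k)//; have [_ _ SE _ _] := SP k; have [] := SE _ _ Sx.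
- move=> x y k xy Gxy; have [_ _ _ /(_ x y (conj xy Gxy))[j Sj] _] := SP k.
  have [fj lk] := codeK j k; exists (code j k) => //.
  by rewrite (sigmaE _ k)// fj.
- move=> i j x /[dup] ix /sigma_neq[k ik Sx] E1 ij.
  rewrite (sigmaE i k)// (sigmaE j k) -?ij// in E1.
  have [_ _ _ _ Su] := SP k; have fij := Su _ _ _ Sx E1.
  by rewrite -(flK i) -(flK j) fij ij.
Qed.

(** Distinct indices that move [x] give distinct edges of [G]; in this way the bounds on degree and
    multiplicity pass from edges to indices. *)
Lemma indices_edges (sigma : nat -> V -> V) (lab : nat -> nat) x (s : seq nat) :
  (forall i x, sigma i x <> x ->
    exists2 k : 'I_m, lab i = k & edges G ([set x; sigma i x], k)) ->
  (forall i j x, sigma i x <> x -> sigma i x = sigma j x -> lab i = lab j -> i = j) ->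
  uniq s -> (forall i, i \in s -> sigma i x <> x) ->
  exists es : seq (edge V m), [/\ uniq es, size es = size s &
    forall e, e \in es -> exists2 i, i \in s & edges G e /\ e.1 = [set x; sigma i x]].
Proof.
case: s => [|i0 s] sG su us sx; first by exists [::].
have [k0 _ _] := sG i0 x (sx _ (mem_head _ _)).
have /choice[e eP] : forall i, exists k : 'I_m, sigma i x <> x ->
    lab i = k /\ edges G ([set x; sigma i x], k).
  move=> i; have [ix|ix] := pselect (sigma i x = x); first by exists k0.
  by have [k ik Gk] := sG i x ix; exists k.
exists [seq ([set x; sigma i x], e i) | i <- i0 :: s]; split.
- rewrite map_inj_in_uniq// => i j si sj Eij.
  have E1 : [set x; sigma i x] = [set x; sigma j x] := congr1 fst Eij.
  have kk : e i = e j := congr1 snd Eij.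
  have ix := sx i si; have jx := sx j sj.
  have [li _] := eP i ix; have [lj _] := eP j jx.
  apply: (su i j x) => //; last by rewrite li lj kk.
  by have [[_ ->]//|[_ /ix]] := set2_eq E1.
- by rewrite size_map.
- move=> _ /mapP[i si ->]; exists i => //; split => //.
  by have [] := eP i (sx i si).
Qed.

Lemma chromatic_index_restrict q (sigma : nat -> V -> V) (lab : nat -> nat)
    (c : coloring V q) (A : set V) (mA : measurable A) :
  (forall i, measurable_fun setT (sigma i)) -> (forall i, involutive (sigma i)) ->
  (forall i x, sigma i x <> x ->
    exists2 k : 'I_m, lab i = k & edges G ([set x; sigma i x], k)) ->
  (forall x y (k : 'I_m), x <> y -> edges G ([set x; y], k) ->
    exists2 i, lab i = k & sigma i x = y) ->
  (forall i j x, sigma i x <> x -> sigma i x = sigma j x -> lab i = lab j -> i = j) ->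
  measurable_coloring c -> proper sigma c ->
  (forall i x, A x -> ~ uncolored sigma c i x) ->
  borel_chromatic_index R (Defs.restrict G mA) <= q%:R%:E.
Proof.
move=> ms sK sG Gs su mc [cs cd cp] Ac; apply: ereal_inf_lbound; exists q => //.
pose M (a : 'I_q) : set (edge V m) := [set e : edge V m | exists i x, [/\ A x, A (sigma i x),
  c i x = Some a & e.1 = [set x; sigma i x] /\ lab i = nat_of_ord e.2]].
(* A coloured edge can be read from either end; two edges of one colour that share a vertex are
   compared there. *)
have ME a u k : M a (u, k) -> forall z, u z -> exists i, [/\ A z, A (sigma i z),
    c i z = Some a & u = [set z; sigma i z] /\ lab i = k].
  move=> [i [x [Ax Asx cx [/= -> ik]]]] z [->|->]; exists i; first by split.
  by rewrite sK cs setUC.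
exists M; split.
- move=> a; split.
    move=> k; rewrite (_ : [set _ | _] = [set p : V * V | p.1 <> p.2 /\
        ((A p.1 /\ A p.2) /\ exists i, lab i = k /\ (c i p.1 = Some a /\ sigma i p.1 = p.2))]).
      have mfst : measurable_fun setT (@fst V V) by exact: measurable_fst.
      have msnd : measurable_fun setT (@snd V V) by exact: measurable_snd.
      apply: mset_and; first by apply: mset_not; exact: (measurable_eqfun phiI mphi).
      apply: mset_and.
        apply: mset_and.
          exact: (@measurable_comp_pred _ _ _ _ (@fst V V) A).
        exact: (@measurable_comp_pred _ _ _ _ (@snd V V) A).
      apply: mset_exN => i _; apply: mset_and; first exact: measurable_color.
      apply: (measurable_eqfun phiI mphi) => //.
      exact: measurableT_comp.
    apply/seteqP; split=> -[x y] /=.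
      move=> [xy Mxy]; split => //.
      have [i [Ax Asx cx [E ik]]] := ME _ _ _ Mxy x (or_introl erefl).
      have sy : sigma i x = y.
        by have [[_ ->]//|[_ yx]] := set2_eq E; case: xy.
      by rewrite sy in Asx; split => //; exists i.
    move=> [xy [[Ax Ay] [i [ik [cx sx]]]]]; split => //; exists i, x.
    by rewrite /= sx.
  move=> [u k] [u' k'] Mu Mu' [z [/= uz u'z]].
  have [i [_ _ ci [-> ik]]] := ME _ _ _ Mu z uz.
  have [j [_ _ cj [-> jk]]] := ME _ _ _ Mu' z u'z.
  have ij := cp _ _ _ _ ci cj; rewrite ij in ik *; congr pair.
  by apply: ord_inj; rewrite -ik -jk.
- move=> a b _ _ [[u k] [Ma Mb]].
  have [i0 [x0 [_ _ _ [/= uE _]]]] := Ma.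
  have ux : u x0 by rewrite uE; left.
  have [i [_ _ ci [uE1 ik]]] := ME _ _ _ Ma x0 ux.
  have [j [_ _ cj [uE2 jk]]] := ME _ _ _ Mb x0 ux.
  have six := cd _ _ _ ci.
  have sij : sigma i x0 = sigma j x0.
    by have [[_ ->]//|[]] := set2_eq (etrans (esym uE1) uE2) => _ /six.
  have ij : i = j by apply: (su i j x0) => //; rewrite ik jk.
  by move: cj; rewrite -ij ci => -[].
- apply/seteqP; split=> [[u k] [a _ Ma]|[u k] [Gu [[[x y] /= [Ax Ay xy] uE] _]]].
    have [i [x [Ax Asx cx [/= uE ik]]]] := Ma.
    have six := cd _ _ _ cx; have [k' ik' Gk] := sG i x six.
    have kk' : k = k' by apply: ord_inj; rewrite -ik.
    split; first by rewrite uE kk'.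
    by split => //; exists (x, sigma i x) => //; split => //; exact: nesym.
  subst u; have [i ik sy] := Gs x y k xy Gu.
  case E : (c i x) => [a|]; last first.
    by case: (Ac i x Ax); split => //; rewrite sy; exact: nesym.
  by exists a => //; exists i, x; rewrite sy.
Qed.

End graph.

End assembly.

Local Open Scope ereal_scope.

Theorem theorem1p8 (R : realType) (d : measure_display) (V : measurableType d)
    (hV : standard_borel R V) (m : nat) (G : borel_multigraph [set: V] m)
    (hG : max_degree R G < +oo) (mu : probability V R) :
  approximate_chromatic_index mu G <= max_degree R G + max_multiplicity R G.
Proof.
have [Delta [pi [degG multG DpG]]] := finite_degree_multiplicity hG.
have [phi [phiI mphi mrange phiE]] := standard_borel_coding hV.
have [sigma [lab [sP sG Gs su]]] := edge_system degG phiI mphi mrange phiE.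
have ms i : measurable_fun setT (sigma i) by have [] := sP i.
have sK i : involutive (sigma i) by have [] := sP i.
apply: le_trans DpG; apply: ereal_inf_lbound; exists (Delta + pi)%N => // eps eps0.
have degs x (s : seq nat) : uniq s -> (forall i, i \in s -> sigma i x <> x) ->
    (size s <= Delta)%N.
  move=> us sx; have [es [ues <- esP]] := indices_edges sG su us sx.
  apply: (degG x) => // e /esP[i _ [Ge ->]]; split => //; by left.
have /choice[darts dartsP] := fun x => bounded_finite (degs x).
have [||||c [mc okc cA]] := approximate_coloring mu phiI mphi sK ms
  (Delta := Delta) (mult := pi) (darts := darts) (q := (Delta + pi)%N) _ _ _ _ eps0.
- by move=> x i; have [_ _ h] := dartsP x; exact: h.
- by move=> x; have [_ h _] := dartsP x.
- move=> x y yx; have [ud _ dP] := dartsP x; rewrite -size_filter.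
  have ds i : i \in [seq i <- darts x | sigma i x == y] -> sigma i x <> x.
    by rewrite mem_filter => /andP[_ /dP].
  have [es [ues <- esP]] := indices_edges sG su (filter_uniq _ ud) ds.
  apply: (multG [set x; y]) => // e /esP[i].
  by rewrite mem_filter => /andP[/eqP -> _].
- by [].
pose B := [set x | exists i, uncolored sigma c i x].
have mB : measurable B.
  apply: mset_ex => i.
  exact: (measurable_uncolored phiI mphi ms mc (@measurable_id _ V setT)).
exists (~` B), (measurableC mB); rewrite setCK; split => //.
apply: (chromatic_index_restrict R phiI mphi (measurableC mB) ms sK sG Gs su mc okc).
by move=> i x Bx ux; apply: Bx; exists i.
Qed.
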